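(* Let $R=a\times b$ denote the rectangular Young diagram with $a$ rows of length $b$, and let $\nu$ be a Young diagram with $R\subseteq\nu$. (I) If $T\in {\tt INC}(\nu/R)$, then the $K$-rectification $K{\tt rect}(T)$ is independent of the rectification order. (II) Fix a straight shape $\mu$. The number of tableaux $T\in {\tt INC}(\nu/R)$ that $K$-rectify to a given $C\in {\tt INC}(\mu)$ does not depend on the choice of $C\in{\tt INC}(\mu)$.
   Context: Young diagrams are drawn in English notation. For Young diagrams $\lambda\subseteq\nu$, an increasing tableau of skew shape $\nu/\lambda$ is a filling of the boxes of $\nu/\lambda$ with positive integers strictly increasing from left to right along rows and from top to bottom along columns; ${\tt INC}(\nu/\lambda)$ is the set of these. A short ribbon is an edge-connected skew shape containing no $2\times 2$ square and with at most two boxes in each row and each column. An alternating ribbon is a short ribbon filled with two symbols so that edge-adjacent boxes carry different symbols; ${\tt switch}$ of an alternating ribbon interchanges the two symbols in every box, except that a ribbon consisting of a single box is left unchanged; ${\tt switch}$ acts on a disjoint union of alternating ribbons by acting on each separately. Given $T\in{\tt INC}(\nu/\lambda)$, an inner corner is a maximally southeast box of $\lambda$ (a box whose removal from $\lambda$ leaves a Young diagram). A $K{\tt jdt}$ slide: choose a nonempty set of inner corners and place a symbol $\bullet$ in each; then for $i=1,2,\ldots$ up to the largest entry, consider the boxes containing $\bullet$ or $i$ (their edge-connected components form a union of alternating ribbons) and apply ${\tt switch}$ to them. After all labels have been processed, erase the $\bullet$'s; the resulting increasing tableau is $K{\tt jdt}_{\{x_i\}}(T)$. A $K$-rectification of $T$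 is obtained by iterating $K{\tt jdt}$ slides until the shape is a straight shape (a partition); the choice of the sequence of slides is the rectification order, and the result is denoted $K{\tt rect}(T)$. *)

(* Defs.v *)
(* MathComp, with finite sets and maps from the finmap library. *)
From mathcomp Require Import all_boot finmap.

Set Implicit Arguments.
Unset Strict Implicit.
Unset Printing Implicit Defensive.

Local Open Scope fset_scope.
Local Open Scope fmap_scope.

(* (row, column), both numbered from 0; rows go down and columns go right *)
Definition box := (nat * nat)%type.

Definition young_diagram (D : {fset box}) : Prop :=
  forall i j i' j' : nat, (i', j') \in D -> i <= i' -> j <= j' -> (i, j) \in D.

Definition rectangle (a b : nat) : {fset box} :=
  [fset x in [seq (i, j) | i <- iota 0 a, j <- iota 0 b]].

Definition filling := {fmap box -> nat}.

(* T \in INC(nu / lam), for Young diagrams lam contained in nu *)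
Definition INC (nu lam : {fset box}) (T : filling) : Prop :=
  [/\ domf T = nu `\` lam,
      forall (x : box) (u : nat), T.[? x] = Some u -> 0 < u,
      forall i j j' u v : nat, T.[? (i, j)] = Some u -> T.[? (i, j')] = Some v ->
        j < j' -> u < v
    & forall i i' j u v : nat, T.[? (i, j)] = Some u -> T.[? (i', j)] = Some v ->
        i < i' -> u < v].

Definition adjacent (x y : box) : bool :=
  (x.1 == y.1) && ((x.2.+1 == y.2) || (y.2.+1 == x.2)) ||
  (x.2 == y.2) && ((x.1.+1 == y.1) || (y.1.+1 == x.1)).

(* The edge-connected component of x in A; it is [set x] if x is not in A. *)
Definition component (D : {fset box}) (A : pred D) (x : D) : {set D} :=
  [set y | connect [rel u v : D | [&& A u, A v & adjacent (val u) (val v)]] x y].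

(* The switch of the components of the boxes that contain s or t. It is only
   meant for the case where these components are alternating ribbons, but is
   defined by the same formula for all fillings. *)
Definition switch (s t : nat) (U : filling) : filling :=
  let A : pred (domf U) := fun x => (U x == s) || (U x == t) in
  [fmap x : domf U =>
     if A x && (1 < #|component A x|) then if U x == s then t else s
     else U x].

(* Labels are positive, so 0 can serve as the symbol that marks the boxes to
   be filled. *)
Definition bullet : nat := 0.

Definition place_bullets (X : {fset box}) (T : filling) : filling :=
  T + [fmap x : X => bullet].

Definition erase_bullets (U : filling) : filling :=
  U.[\ [fset x in domf U | U.[? x] == Some bullet]].

Definition max_entry (T : filling) : nat := \max_(x : domf T) T x.

Definition Kjdt (T : filling) (X : {fset box}) : filling :=
  erase_bullets
    (foldl (fun U i => switch bullet i U) (place_bullets X T)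
           (iota 1 (max_entry T))).

Definition inner_corner (lam : {fset box}) (x : box) : Prop :=
  x \in lam /\ young_diagram (lam `\ x).

(* The inner shape of Kjdt T X is lam `\` X when that of T is lam. A
   rectification order is given by the successive sets of inner corners; it is
   complete when the inner shape is empty. *)
Fixpoint rectification_order (lam : {fset box}) (o : seq {fset box}) : Prop :=
  if o is X :: o' then
    [/\ X != fset0, forall x : box, x \in X -> inner_corner lam x
      & rectification_order (lam `\` X) o']
  else lam = fset0.

Definition Krect (T : filling) (o : seq {fset box}) : filling := foldl Kjdt T o.

(* T is a tableau whose inner shape is lam. *)
Definition Krectifies_to (lam : {fset box}) (T C : filling) : Prop :=
  exists2 o, rectification_order lam o & Krect T o = C.

(* Main.v *)
(* Record a rectification of T in one grid on nu: the box r of the rectangle lam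
   starts with a label of its own, the other boxes with their entries in T, and
   a slide switches the labels of the chosen corners with 1, 2, ... in turn.
   Switches of disjoint pairs of symbols commute, so the entry 1 may be moved
   past all the labels first, then the entry 2, and so on.  Throughout, for
   p < p', the cells labelled (p, q) lie strictly above and weakly to the right
   of those labelled (p', q), and the transposed statement holds.  If a cell had
   incomparable labels above it and to its left, it would then carry itself the
   label with the larger coordinates of both, which exists because lam is a
   rectangle; so an entry being moved never meets two incomparable labels, and
   the order of the slides is irrelevant.  The condition is also invariant under
   a half turn, so that the process can be run backwards from any tableau C on
   mu and any such labelling of nu / mu, and it ends with the identity labelling
   since that is the only one on a straight shape.  Thus the tableaux that
   rectify to C correspond to the labellings of nu / mu, whatever C is. *)
Require Import Defs.
From mathcomp Require Import all_boot all_order all_algebra finmap zify.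
From Stdlib Require Import FunctionalExtensionality ClassicalEpsilon.

Set Implicit Arguments.
Unset Strict Implicit.
Unset Printing Implicit Defensive.

Import Order.TTheory GRing.Theory.

(** The obstacle is that a slide treats all its corners as one symbol, while the invariant speaks of
    individual boxes. Hence two kinds of grid are used: one with a label for each box, and its image
    under [collapse], where a label is only the number of its slide. They agree because labels that
    are maximal among those still to be passed are never adjacent, and no bullet touches two
    different ones, so switching them one by one or together is the same. For the same reason two
    such labels may be exchanged, hence any two linear extensions of the box order, read from the
    southeast, have the same effect and the slide numbers disappear from the result. Once an entry
    has passed every label, the situation is the initial one for the next entry. In the count, all
    entries precede all labels in the final grid, so the condition on the labels outside [mu] cannot
    see the values of [C]; this is why one finite set of labellings serves every [C]. *)

(* Integer coordinates make transposition and the half turn maps on cells. *)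
Definition cell := (int * int)%type.
Definition grid (A : Type) := cell -> option A.

(** * Switches of two symbols on a grid *)

Section Switch.
Variable A : eqType.
Implicit Types (s t u : A) (G : grid A) (x y : cell).
Local Open Scope ring_scope.

Definition nbrs x : seq cell :=
  [:: (x.1 - 1, x.2); (x.1, x.2 - 1); (x.1 + 1, x.2); (x.1, x.2 + 1)].

Definition on s t (o : option A) := (o == Some s) || (o == Some t).

Definition touched s t G x := has (fun y => on s t (G y)) (nbrs x).

(** A component of the cells carrying [s] or [t] has more than one cell exactly when each of its
    cells has a neighbour in it, so a local test replaces connectivity. *)
Definition sw s t G : grid A := fun x =>
  if on s t (G x) && touched s t G x
  then if G x == Some s then Some t else Some s else G x.

Lemma on_sw s t G x : on s t (sw s t G x) = on s t (G x).
Proof.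
rewrite /sw; case: ifP => // /andP[-> _].
by case: ifP; rewrite /on eqxx ?orbT.
Qed.

Lemma touched_sw s t G x : touched s t (sw s t G) x = touched s t G x.
Proof. by apply: eq_has => y; rewrite on_sw. Qed.

Lemma sw_off s t G x : ~~ on s t (G x) -> sw s t G x = G x.
Proof. by rewrite /sw => /negbTE->. Qed.

(** The switch preserves the set of cells carrying [s] or [t], hence also the test [touched]. This
    makes the whole process reversible. *)
Lemma swK s t G : s != t -> sw s t (sw s t G) = G.
Proof.
move=> st; apply: functional_extensionality => x.
have := touched_sw s t G x; have := on_sw s t G x.
set H := sw s t G => oH tH; rewrite /sw oH tH /H /sw.
case c: (on s t (G x) && touched s t G x) => //.
case: (G x =P Some s) => [->|ns].
  by rewrite (inj_eq (@Some_inj _)) eq_sym (negbTE st).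
by rewrite eqxx; case/andP: c => /orP[] /eqP.
Qed.

Lemma on_off s t s' t' G x : s != s' -> s != t' -> t != s' -> t != t' ->
  on s' t' (G x) -> ~~ on s t (G x).
Proof.
move=> a b c d; rewrite /on => /orP[] /eqP->;
by rewrite !(inj_eq (@Some_inj _)) negb_or ![_ == s]eq_sym ![_ == t]eq_sym ?a ?b ?c ?d.
Qed.

Lemma on_sw_other s t s' t' G x : s != s' -> s != t' -> t != s' -> t != t' ->
  on s t (sw s' t' G x) = on s t (G x).
Proof.
move=> a b c d; case o: (on s' t' (G x)); last by rewrite sw_off ?o.
have o' : on s' t' (sw s' t' G x) by rewrite on_sw.
by rewrite (negbTE (on_off a b c d o)) (negbTE (on_off a b c d o')).
Qed.

Lemma sw_comm s t s' t' G : s != s' -> s != t' -> t != s' -> t != t' ->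
  sw s t (sw s' t' G) = sw s' t' (sw s t G).
Proof.
move=> a b c d; apply: functional_extensionality => x.
have [a' b' c' d'] : [/\ s' != s, t' != s, s' != t & t' != t] by rewrite ![_ == s]eq_sym ![_ == t]eq_sym.
have E1 : touched s t (sw s' t' G) x = touched s t G x.
  by apply: eq_has => y; rewrite on_sw_other.
have E2 : touched s' t' (sw s t G) x = touched s' t' G x.
  by apply: eq_has => y; rewrite on_sw_other.
case o: (on s' t' (G x)).
  have n := on_off a b c d o.
  rewrite sw_off ?on_sw_other //.
  by rewrite /sw E2 [in RHS](negbTE n) /= .
rewrite [RHS]sw_off ?on_sw_other ?o //.
by rewrite /sw E1 o /=.
Qed.

Lemma sw_src s t G x u : sw s t G x = Some u ->
  [\/ G x = Some u, u = s | u = t].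
Proof.
rewrite /sw; case: ifP => _; last by constructor 1.
by case: ifP => _ [<-]; [constructor 3|constructor 2].
Qed.

Lemma sw_dom s t G x : (sw s t G x == None) = (G x == None).
Proof.
rewrite /sw; case: ifP => // /andP[/orP[]/eqP-> _]; by case: ifP.
Qed.

End Switch.

Section SwitchMap.
Variables (A B : eqType) (h : option A -> option B).

(** The map [h] may merge or erase other symbols, provided that the cells of [s] and [t] stay
    exactly recognizable. It serves to hide the labels of other slides. *)
Lemma sw_map (s t : A) (s' t' : B) (G : grid A) :
  (forall x, (h (G x) == Some s') = (G x == Some s)) ->
  (forall x, (h (G x) == Some t') = (G x == Some t)) ->
  h (Some s) = Some s' -> h (Some t) = Some t' ->
  sw s' t' (fun x => h (G x)) = fun x => h (sw s t G x).
Proof.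
move=> hs ht es et; apply: functional_extensionality => x.
have E y : on s' t' (h (G y)) = on s t (G y) by rewrite /on hs ht.
rewrite /sw hs E; have -> : touched s' t' (fun y => h (G y)) x = touched s t G x.
  by apply: eq_has => y; exact: E.
by case: ifP => // _; case: ifP.
Qed.
End SwitchMap.

(* inl r is the label of the box r of the inner shape, inr a the entry a. *)
Definition sym := (cell + int)%type.

(** * Moving one entry past the labels of a rectangle *)

Section MovingBullet.
Local Open Scope ring_scope.
Implicit Types (R J : pred cell) (G : grid sym) (i a p q : int) (x y z r w : cell).

Definition le2 x y := x.1 <= y.1 /\ x.2 <= y.2.

Definition covers x y := y = (x.1 + 1, x.2) \/ y = (x.1, x.2 + 1).

(** Entries receive even values, with the moving entry [i] at 0. This leaves -1 and 1, just before
    and just after it, for the labels still to be passed and those already passed. *)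
Definition cls J i (u : sym) : int :=
  match u with inl r => if J r then 1 else -1 | inr a => (a - i) * 2 end.

Definition ht (u : sym) : int := if u is inl r then r.1 + r.2 else 0.

Definition prec J i (u v : sym) :=
  cls J i u < cls J i v \/ cls J i u = cls J i v /\ ht u < ht v.

Lemma eq_cell x y : x.1 = y.1 -> x.2 = y.2 -> x = y.
Proof. by case: x y => [a b] [a' b'] /= -> ->. Qed.

(* The state of the grid while the entry i is moved past the labels in R, those in
   J having been passed; i is called the bullet below. *)
Record good R J i G : Prop := Good {
  good_convex : forall x y z, le2 x y -> le2 y z ->
    G x <> None -> G z <> None -> G y <> None;
  good_label : forall x r, G x = Some (inl r) -> R r;
  good_onto : forall r, R r -> exists x, G x = Some (inl r);
  good_col : forall x y p p' q, G x = Some (inl (p, q)) ->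
    G y = Some (inl (p', q)) -> p < p' -> x.1 < y.1 /\ y.2 <= x.2;
  good_row : forall x y p q q', G x = Some (inl (p, q)) ->
    G y = Some (inl (p, q')) -> q < q' -> x.2 < y.2 /\ y.1 <= x.1;
  good_strict : forall x y u v, covers x y -> G x = Some u -> G y = Some v ->
    prec J i u v }.

Definition rect R := forall p q p' q', R (p, q) -> R (p', q') -> R (p, q').
Definition upper R J := forall r r', R r -> R r' -> J r -> le2 r r' -> J r'.

Lemma prec_trans J i (u v w : sym) : prec J i u v -> prec J i v w -> prec J i u w.
Proof. rewrite /prec; lia. Qed.

Lemma prec_irr J i u : ~ prec J i u u.
Proof. rewrite /prec; lia. Qed.

(** * Consequences of the invariant for pairs of cells *)

Section GoodGrids.
Variables (R J : pred cell) (i : int) (G : grid sym).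
Hypotheses (rectR : rect R) (upJ : upper R J) (g : good R J i G).

(** Convexity keeps a lattice path from [x] to [y] inside the shape, and [good_strict] is chained
    along it. *)
Lemma good_lt x y u v : le2 x y -> x <> y -> G x = Some u -> G y = Some v ->
  prec J i u v.
Proof.
have [n] := ubnP (absz ((y.1 - x.1) + (y.2 - x.2))); elim: n y v => // n IH y v.
move=> dn [le1 le2'] neq Gx Gy.
have [y' [c l1 l2 d]] : exists y', [/\ covers y' y, le2 x y', le2 y' y &
    (absz ((y'.1 - x.1) + (y'.2 - x.2))%R < n)%N].
  case: (ltP x.1 y.1) => h.
    exists (y.1 - 1, y.2); split; rewrite /le2 /=; try lia.
    by left; apply: eq_cell => /=; lia.
  exists (y.1, y.2 - 1).
  have h2 : x.2 < y.2.
    suff : x.2 != y.2 by lia.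
    apply/eqP => e; apply: neq; apply: eq_cell => //; lia.
  split; rewrite /le2 /=; try lia.
  by right; apply: eq_cell => /=; lia.
case Gy' : (G y') => [u'|]; last first.
  by case: (@good_convex _ _ _ _ g x y' y) => //; rewrite ?Gx ?Gy.
have p1 := good_strict g c Gy' Gy.
case: (x =P y') => [e|ne]; last exact: prec_trans (IH _ _ d l1 ne Gx Gy') p1.
by move: Gx; rewrite e Gy' => -[<-].
Qed.

Lemma good_le x y u v : le2 x y -> G x = Some u -> G y = Some v ->
  u = v \/ prec J i u v.
Proof.
move=> l Gx Gy; case: (x =P y) => [e|ne]; last by right; exact: good_lt Gx Gy.
by left; move: Gx; rewrite e Gy => -[].
Qed.

(** The label with the row of [r'] and the column of [r] exists because [R] is a rectangle. It comes
    after [r] in its column and after [r'] in its row, so its cell [c] is squeezed between the two,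
    and [y] is strictly southwest of [x]. *)
Lemma good_NE x y r r' : G x = Some (inl r) -> G y = Some (inl r') ->
  r.1 < r'.1 -> r'.2 < r.2 -> 
  exists c, [/\ G c = Some (inl (r'.1, r.2)), x.1 < c.1, c.1 <= y.1, y.2 < c.2 & c.2 <= x.2].
Proof.
case: r r' => [p q] [p' q'] /= Gx Gy pp qq.
have [c Gc] := good_onto g (rectR (good_label g Gy) (good_label g Gx)).
exists c; have := good_col g Gx Gc pp; have := good_row g Gy Gc qq.
by move=> [? ?] [? ?]; split.
Qed.

(** By [good_NE], of two cells with incomparable labels one is strictly northeast of the other. *)
Lemma good_comparable x y r r' : le2 x y ->
  G x = Some (inl r) -> G y = Some (inl r') -> le2 r r' \/ le2 r' r.
Proof.
move=> [l1 l2] Gx Gy; rewrite /le2.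
case: (ltP r.1 r'.1) => h1; case: (ltP r.2 r'.2) => h2; try lia.
  case: (ltP r'.2 r.2) => h3; last lia.
  have [c [_ ? ? ? ?]] := good_NE Gx Gy h1 h3; lia.
case: (ltP r'.1 r.1) => h3; last lia.
have [c [_ ? ? ? ?]] := good_NE Gy Gx h3 h2; lia.
Qed.

(* If u and v are incomparable, x is the cell found by good_NE. *)
Lemma good_fork x u v : G (x.1 - 1, x.2) = Some (inl u) ->
  G (x.1, x.2 - 1) = Some (inl v) ->
  [\/ le2 u v, le2 v u | exists z, G x = Some (inl z)].
Proof.
move=> Gu Gv; rewrite /le2.
case: (ltP u.1 v.1) => h1; case: (ltP u.2 v.2) => h2.
- by constructor 1; lia.
- case: (ltP v.2 u.2) => h3; last by constructor 1; lia.
  have [c [Gc /= ? ? ? ?]] := good_NE Gu Gv h1 h3.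
  constructor 3; exists (v.1, u.2); rewrite -Gc; congr G.
  by apply: eq_cell; rewrite /=; lia.
- case: (ltP v.1 u.1) => h3; last by constructor 1; lia.
  have [c [_ /= ? ? ? ?]] := good_NE Gv Gu h3 h2; lia.
- by constructor 2; lia.
Qed.

End GoodGrids.

Definition north x : cell := (x.1 - 1, x.2).
Definition west x : cell := (x.1, x.2 - 1).
Definition south x : cell := (x.1 + 1, x.2).
Definition east x : cell := (x.1, x.2 + 1).

Lemma covers_north x : covers (north x) x.
Proof. by left; apply: eq_cell => /=; lia. Qed.
Lemma covers_west x : covers (west x) x.
Proof. by right; apply: eq_cell => /=; lia. Qed.
Lemma covers_south x : covers x (south x). Proof. by left. Qed.
Lemma covers_east x : covers x (east x). Proof. by right. Qed.

Lemma coversP x y : covers x y ->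
  x = north y /\ y = south x \/ x = west y /\ y = east x.
Proof.
by case=> ->; [left|right]; split => //; apply: eq_cell => /=; lia.
Qed.

Lemma covers_le2 x y : covers x y -> le2 x y.
Proof. by case=> ->; rewrite /le2 /=; lia. Qed.

Lemma touchedP (A : eqType) (s t : A) (G : grid A) x :
  reflect (exists2 y, covers x y \/ covers y x & on s t (G y)) (touched s t G x).
Proof.
apply: (iffP hasP) => -[y yx ony]; exists y => //.
  move: yx; rewrite !inE => /or4P[] /eqP->.
  - by right; exact: covers_north.
  - by right; exact: covers_west.
  - by left; exact: covers_south.
  - by left; exact: covers_east.
rewrite !inE; case: yx => [[->|->]|/coversP[[-> _]|[-> _]]];
by rewrite eqxx ?orbT.
Qed.

(** * Preservation of the invariant when the bullet passes one label *)

Section OneSwitch.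
Variables (R J : pred cell) (i : int) (G : grid sym) (r : cell).
Hypotheses (rectR : rect R) (upJ : upper R J) (g : good R J i G).
Hypotheses (Rr : R r) (nJr : ~~ J r).
Hypothesis rmax : forall r', R r' -> le2 r r' -> r' = r \/ J r'.

Let G' := sw (inl r) (inr i) G.
Let J' : pred cell := fun z => (z == r) || J z.

Lemma cls_t : cls J i (inr i) = 0.
Proof. by rewrite /cls subrr mul0r. Qed.

Lemma cls_r : cls J i (inl r) = -1.
Proof. by rewrite /= (negbTE nJr). Qed.

Variant sw_spec x v : Prop :=
| SwOther of G x = Some v & v <> inl r & v <> inr i
| SwKeepR of v = inl r & G x = Some (inl r)
    & (forall y, covers x y -> G y <> Some (inr i))
| SwKeepT of v = inr i & G x = Some (inr i)
    & (forall y, covers y x -> G y <> Some (inl r))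
| SwNewR y of v = inl r & G x = Some (inr i) & covers y x & G y = Some (inl r)
| SwNewT y of v = inr i & G x = Some (inl r) & covers x y & G y = Some (inr i).

(** As [r] is still to be passed, it precedes the bullet in [prec], and strictness allows only one
    adjacency of the two: [r] north or west of the bullet. Thus [r] moves only south or east, and
    the bullet only north or west. *)
Lemma swP x v : G' x = Some v -> sw_spec x v.
Proof.
rewrite /G' /sw.
have tt y z : covers y z -> G y = Some (inr i) -> G z = Some (inr i) -> False.
  by move=> c a b; apply: prec_irr (good_strict g c a b).
have rr y z : covers y z -> G y = Some (inl r) -> G z = Some (inl r) -> False.
  by move=> c a b; apply: prec_irr (good_strict g c a b).
have tr y z : covers y z -> G y = Some (inr i) -> G z = Some (inl r) -> False.
  move=> c a b; have := good_strict g c a b.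
  by rewrite /prec cls_t cls_r; lia.
case: ifP => [/andP[/orP[]/eqP Gx /touchedP[y yx /orP[]/eqP Gy]]|c].
- by case: yx => yx; [case: (rr _ _ yx Gx Gy)|case: (rr _ _ yx Gy Gx)].
- rewrite Gx eqxx => -[<-]; case: yx => yx; first exact: SwNewT Gy.
  by case: (tr _ _ yx Gy Gx).
- rewrite Gx /= => -[<-]; case: yx => yx; last exact: SwNewR Gy.
  by case: (tr _ _ yx Gx Gy).
- by case: yx => yx; [case: (tt _ _ yx Gx Gy)|case: (tt _ _ yx Gy Gx)].
move=> Gx; case: (v =P inl r) => [e|nr].
  apply: SwKeepR => // [|y yx]; first by rewrite -e.
  move=> Gy; move: c; rewrite Gx e /on eqxx /= => /touchedP[].
  by exists y; [left|rewrite Gy /on eqxx orbT].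
case: (v =P inr i) => [e|ni]; last exact: SwOther.
apply: SwKeepT => // [|y yx]; first by rewrite -e.
move=> Gy; move: c; rewrite Gx e /on eqxx orbT /= => /touchedP[].
by exists y; [right|rewrite Gy /on eqxx].
Qed.

Lemma unprocessed r' : R r' -> le2 r r' -> r' <> r -> J r'.
Proof. by move=> Rr' l ne; case: (rmax Rr' l). Qed.

Lemma cls_other u : u <> inl r -> cls J' i u = cls J i u.
Proof. by case: u => [u|//] ne; rewrite /= /J'; case: eqP => // e; case: ne; rewrite e. Qed.

Lemma cls_r' : cls J' i (inl r) = 1.
Proof. by rewrite /= /J' eqxx. Qed.

Lemma cls_t' : cls J' i (inr i) = 0.
Proof. by rewrite /= subrr mul0r. Qed.

Lemma cls_neq0 u : u <> inr i -> cls J i u <> 0.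
Proof.
case: u => [u|a] ne /=; first by case: ifP.
by move=> e; apply: ne; congr inr; lia.
Qed.

Lemma cls_before u : u <> inr i -> prec J i u (inl r) \/ prec J i u (inr i) ->
  cls J i u < 0.
Proof.
move=> /cls_neq0; rewrite /prec cls_r cls_t; case: u => [u|a] /=; lia.
Qed.

(** The two labels are comparable. If [r'] were the smaller one, [upper] would forbid it to be
    passed before [r], and as an unpassed label it could not follow [r] in [prec]. *)
Lemma label_after x y r' : le2 x y -> G x = Some (inl r) -> G y = Some (inl r') ->
  r' <> r -> J r' /\ r.1 + r.2 < r'.1 + r'.2.
Proof.
move=> l Gx Gy ne.
have lrr : le2 r r'.
  have [//|l'] := good_comparable rectR g l Gx Gy.
  have [e|] := good_le g l Gx Gy; first by case: ne; case: e.
  rewrite /prec cls_r /=; case: ifP => Jr'; last first.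
    by move=> h; exfalso; case: l'; move: h; lia.
  by move: nJr; rewrite (upJ (good_label g Gy) Rr Jr' l').
split; first exact: unprocessed (good_label g Gy) lrr ne.
case: lrr => l1 l2; case: (ltP r.1 r'.1) => h; first lia.
case: (ltP r.2 r'.2) => h'; first lia.
by case: ne; apply: eq_cell; lia.
Qed.

Lemma cls_after x y v : le2 x y -> G x = Some (inl r) -> G y = Some v ->
  v <> inl r -> v <> inr i -> 0 < cls J i v /\ prec J' i (inl r) v.
Proof.
move=> l Gx Gy nr nt; rewrite /prec (cls_other nr) cls_r'.
have := cls_neq0 nt; case: v nr nt Gy => [r'|a] nr nt Gy.
  have [|Jr' h] := label_after l Gx Gy; first by move=> e; apply: nr; rewrite e.
  by rewrite /= Jr'; lia.
have [//|] := good_le g l Gx Gy; rewrite /prec cls_r /=; lia.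
Qed.

(** Apart from the pair itself, a symbol before [r] or the bullet has negative class and a symbol
    after [r] has positive class, so interchanging the pair in the order disturbs no other
    comparison. Where the pair is adjacent, it is interchanged on the grid as well. *)
Lemma step_strict x y (u v : sym) : covers x y -> G' x = Some u -> G' y = Some v ->
  prec J' i u v.
Proof.
move=> c /swP Gx /swP Gy.
have bad (b d : sym) : G x = Some b -> G y = Some d -> ~ prec J i b d -> False.
  by by move=> Gb Gd; apply; apply: (good_strict g c Gb Gd).
have rr : ~ prec J i (inl r) (inl r) by exact: prec_irr.
have tt : ~ prec J i (inr i) (inr i) by exact: prec_irr.
have tr : ~ prec J i (inr i) (inl r) by rewrite /prec cls_t cls_r; lia.
have rt : prec J' i (inr i) (inl r) by rewrite /prec cls_t' cls_r'; lia.
case: Gx => [Gx nr nt|eu Gx ny|eu Gx ny|x0 eu Gx cx Gx0|x0 eu Gx cx Gx0]; subst;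
case: Gy => [Gy nr' nt'|ev Gy ny'|ev Gy ny'|y0 ev Gy cy Gy0|y0 ev Gy cy Gy0]; subst;
try by (case: (bad _ _ Gx Gy)).
- by rewrite /prec (cls_other nr) (cls_other nr'); exact: (good_strict g c Gx Gy).
- have := cls_before nt (or_introl (good_strict g c Gx Gy)).
  by rewrite /prec (cls_other nr) cls_r'; lia.
- by rewrite /prec (cls_other nr); have := good_strict g c Gx Gy; rewrite /prec cls_t cls_t'.
- have := cls_before nt (or_intror (good_strict g c Gx Gy)).
  by rewrite /prec (cls_other nr) cls_r'; lia.
- have := cls_before nt (or_introl (good_strict g c Gx Gy)).
  by rewrite /prec (cls_other nr) cls_t'; lia.
- by case: (cls_after (covers_le2 c) Gx Gy nr' nt').
- by case: (ny _ c Gy).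
- by case: (ny _ c Gy).
- by rewrite /prec (cls_other nr') cls_t'; have := good_strict g c Gx Gy; rewrite /prec cls_t.
(* Here [r] has come from [x0], and [y] is southeast of that cell too. *)
- have l : le2 x0 y by move: (covers_le2 cx) (covers_le2 c); rewrite /le2; lia.
  by case: (cls_after l Gx0 Gy nr' nt').
- case: (cls_after (covers_le2 c) Gx Gy nr' nt') => h _.
  by rewrite /prec (cls_other nr') cls_t'; lia.
- by case: (ny' _ c Gx).
- exact: rt.
Qed.

Lemma old_col x y (r1 r2 : cell) : G x = Some (inl r1) -> G y = Some (inl r2) ->
  r1.2 = r2.2 -> r1.1 < r2.1 -> x.1 < y.1 /\ y.2 <= x.2.
Proof.
by case: r1 r2 => [a b] [a' b'] /= G1 G2 e; subst b'; apply: (good_col g G1 G2).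
Qed.

(** Only a move of [r] to the east could break the column condition, when [x] is in the grid column
    that [r] leaves. Then the cell north of [y] would hold an unpassed label between [w] and [r],
    hence in their label column, and yet strictly right of [x]. *)
Lemma new_col_below x y y0 w : G x = Some (inl w) -> w.2 = r.2 -> w.1 < r.1 ->
  G y = Some (inr i) -> covers y0 y -> G y0 = Some (inl r) ->
  x.1 < y.1 /\ y.2 <= x.2.
Proof.
move=> Gx e1 e2 Gy cy Gy0; have [l1 l2] := old_col Gx Gy0 e1 e2.
case: (coversP cy) => [][ey0 _]; subst y0; rewrite /= in l1 l2 *; first by lia.
split; first lia.
case: (leP y.2 x.2) => // h; exfalso.
have lB : le2 x (north y) by rewrite /le2 /=; lia.
case GB : (G (north y)) => [u|]; last first.
  apply: (good_convex g lB (covers_le2 (covers_north y))) => //; first by rewrite Gx.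
  by rewrite Gy.
have uy := good_strict g (covers_north y) GB Gy.
have nt : u <> inr i by move=> e; apply: prec_irr (_ : prec J i (inr i) (inr i)); rewrite -{1}e.
have cu := cls_before nt (or_intror uy).
have nJw : J w = false.
  by apply/negP => Jw; move: nJr; rewrite (upJ (good_label g Gx) Rr Jw _) // /le2; lia.
have wu : prec J i (inl w) u.
  by apply: (good_lt g lB _ Gx GB) => e; move: h; rewrite {1}e /=; lia.
case: u GB {uy nt} cu wu => [u1|b] GB; rewrite /prec /= nJw; last by lia.
case Ju : (J u1) => // _ wu.
have h1 : le2 w u1.
  by have [//|[]] := good_comparable rectR g lB Gx GB; lia.
(* The labels [u1] and [r] are north and west of a bullet, so [good_fork] makes them comparable, and
   an unpassed [u1] cannot exceed the maximal [r]. *)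
have h2 : le2 u1 r.
  have [//|l|[z]] := good_fork rectR g GB Gy0; last by rewrite Gy.
  have [->|] := rmax (good_label g GB) l; first by [].
  by rewrite Ju.
case: h1 h2 => [h1 h1'] [h2 h2'].
have [||_ /=] := old_col Gx GB; lia.
Qed.

Lemma step_col x y p p' q : G' x = Some (inl (p, q)) ->
  G' y = Some (inl (p', q)) -> p < p' -> x.1 < y.1 /\ y.2 <= x.2.
Proof.
move=> /swP Gx /swP Gy pp.
have same : inl (p, q) = inl r :> sym -> inl (p', q) = inl r :> sym -> False.
  by move=> [e1] [e2]; move: pp; rewrite -e1 in e2; case: e2 => ->; rewrite ltxx.
case: Gx => [Gx nr nt|eu Gx ny|//|x0 eu Gx cx Gx0|//];
case: Gy => [Gy nr' nt'|ev Gy ny'|//|y0 ev Gy cy Gy0|//];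
try by case: (same _ _).
- exact: (old_col Gx Gy).
- by case: ev => ev; apply: (old_col Gx Gy); rewrite -ev.
- by case: ev => ev; apply: (new_col_below Gx _ _ Gy cy Gy0); rewrite -ev.
- by case: eu => eu; apply: (old_col Gx Gy); rewrite -eu.
- case: eu => eu.
  have [] := old_col Gx0 Gy; rewrite -?eu //= => l1 l2.
  case: (coversP cx) => [][ex0 _]; subst x0; rewrite /= in l1 l2 *; last by lia.
  (* If [r] arrived from the north in the row of [y], the label of [y], already passed, would stand
     to the left of the bullet's old cell; but passed labels come after the bullet. *)
  split => //; case: (leP y.1 x.1) => h; last lia; exfalso.
  have Jz : J (p', q).
    apply: (unprocessed (good_label g Gy)); first by rewrite -eu /le2 /=; lia.
    by move=> e; apply: nr'; rewrite e.
  have lyx : le2 y x by rewrite /le2; lia.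
  have : prec J i (inl (p', q)) (inr i).
    by apply: (good_lt g lyx _ Gy Gx) => e; move: Gy; rewrite e Gx.
  by rewrite /prec cls_t /= Jz; lia.
Qed.

Lemma step_onto r' : R r' -> exists x, G' x = Some (inl r').
Proof.
move=> Rr'; have [x Gx] := good_onto g Rr'.
case: (r' =P r) => [e|ne]; last first.
  exists x; rewrite /G' sw_off // Gx /on; apply/norP; split => //.
  by apply/eqP => -[].
subst r'; case touch : (touched (inl r) (inr i) G x); last first.
  by exists x; rewrite /G' /sw touch andbF.
have on_t y0 : G y0 = Some (inr i) -> on (inl r) (inr i) (G y0).
  by move=> ->; rewrite /on eqxx orbT.
have on_r y0 : G y0 = Some (inl r) -> on (inl r) (inr i) (G y0).
  by move=> ->; rewrite /on eqxx.
case/touchedP: touch => y yx ony.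
case/orP: ony => /eqP Gy.
  by case: yx => c; [have := good_strict g c Gx Gy|have := good_strict g c Gy Gx] => /prec_irr.
exists y; rewrite /G' /sw on_t //=.
suff -> : touched (inl r) (inr i) G y by rewrite Gy.
by apply/touchedP; exists x; [case: yx; [right|left]|apply: on_r].
Qed.

Lemma step_convex x y z : le2 x y -> le2 y z -> G' x <> None -> G' z <> None -> G' y <> None.
Proof.
move=> l1 l2 /eqP hx /eqP hz; apply/eqP; move: hx hz; rewrite !sw_dom.
by move=> /eqP hx /eqP hz; apply/eqP; apply: (good_convex g l1 l2).
Qed.

Lemma step_label x r' : G' x = Some (inl r') -> R r'.
Proof. by case/sw_src => [/(good_label g)|[->]|]. Qed.

End OneSwitch.

(** * Transport of switches along symmetries of the grid *)

Section Conjugate.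
Variables (A : eqType) (tau : cell -> cell) (h : A -> A).
Hypotheses (h_inj : injective h).
Hypothesis tau_covers : forall x y, covers x y \/ covers y x ->
  covers (tau x) (tau y) \/ covers (tau y) (tau x).
Hypothesis tauK : involutive tau.

Definition conj (G : grid A) : grid A := fun x => omap h (G (tau x)).

Lemma sw_conj s t (G : grid A) : sw (h s) (h t) (conj G) = conj (sw s t G).
Proof.
have E o s1 : (omap h o == Some (h s1)) = (o == Some s1).
  by case: o => //= a; rewrite !(inj_eq (@Some_inj _)) (inj_eq h_inj).
have O y : on (h s) (h t) (conj G y) = on s t (G (tau y)) by rewrite /on !E.
apply: functional_extensionality => x; rewrite /sw /conj.
rewrite -/(conj G x) O; have -> : touched (h s) (h t) (conj G) x = touched s t G (tau x).
  apply/touchedP/touchedP => -[y yx ony].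
    by exists (tau y); [exact: tau_covers|rewrite -O].
  by exists (tau y); [rewrite -[x]tauK; exact: tau_covers|rewrite O tauK].
by case: ifP => // _; rewrite /conj E; case: ifP.
Qed.

End Conjugate.

Definition trc x : cell := (x.2, x.1).
Definition trs (u : sym) : sym := if u is inl r then inl (trc r) else u.

Lemma trcK : involutive trc. Proof. by case. Qed.
Lemma trsK : involutive trs. Proof. by case => // -[]. Qed.

Lemma covers_trc x y : covers x y -> covers (trc x) (trc y).
Proof. by case=> ->; [right|left]. Qed.

Lemma good_tr R J i G : good R J i G ->
  good (R \o trc) (J \o trc) i (conj trc trs G).
Proof.
have T (o : option sym) v : omap trs o = Some v -> o = Some (trs v).
  by case: o => //= a [<-]; rewrite trsK.
move=> g; split.
- move=> x y z [? ?] [? ?]; rewrite /conj => hx hz.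
  have : G (trc y) <> None.
    apply: (good_convex g (x := trc x) (z := trc z)); rewrite /le2 //=.
      by case: (G _) hx.
    by case: (G _) hz.
  by case: (G _).
- by move=> x r /T/(good_label g).
- move=> r /(good_onto g)[x Gx]; exists (trc x).
  by rewrite /conj trcK Gx /= trcK.
- by move=> x y p p' q /T Gx /T Gy pp; have := good_row g Gx Gy pp.
- by move=> x y p q q' /T Gx /T Gy pp; have := good_col g Gx Gy pp.
move=> x y u v c /T Gx /T Gy; have := good_strict g (covers_trc c) Gx Gy.
by case: u v {Gx Gy} => [[??]|?] [[??]|?]; rewrite /prec /= ?[_.1 + _]addrC; lia.
Qed.

Lemma conj_covers tau : (forall x y, covers x y -> covers (tau x) (tau y)) ->
  forall x y, covers x y \/ covers y x -> covers (tau x) (tau y) \/ covers (tau y) (tau x).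
Proof. by move=> H x y []/H; [left|right]. Qed.

(** The row condition is the column condition of the transposed grid, so [step_col] is applied a
    second time there. *)
Lemma good_step R J i G r : rect R -> upper R J -> good R J i G ->
  R r -> ~~ J r -> (forall r', R r' -> le2 r r' -> r' = r \/ J r') ->
  good R (fun z => (z == r) || J z) i (sw (inl r) (inr i) G).
Proof.
move=> rectR upJ g Rr nJr rmax; split.
- exact: step_convex g.
- exact: (step_label g Rr).
- exact: (step_onto r g).
- exact: step_col rectR upJ g Rr nJr rmax.
- move=> x y p q q' Gx Gy qq.
  have gt := good_tr g.
  have E : sw (inl (trc r)) (inr i) (conj trc trs G) = conj trc trs (sw (inl r) (inr i) G).
    have := @sw_conj _ trc trs (can_inj trsK) (conj_covers covers_trc) trcK (inl r) (inr i) G.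
    by [].
  apply: (@step_col _ _ _ _ (trc r) _ _ gt _ _ _ (trc x) (trc y) q q' p) => //.
  + by move=> ? ? ? ? h1 h2; exact: rectR h2 h1.
  + by move=> ? ? h0 h1 h2 [? ?]; apply: upJ h0 h1 h2 _.
  + by rewrite /= trcK.
  + by rewrite /= trcK.
  + move=> r' Rr' [? ?]; have [||e|] := rmax (trc r') => //; last by right.
    by left; rewrite -e trcK.
  + by rewrite E /conj trcK Gx.
  + by rewrite E /conj trcK Gy.
exact: step_strict rectR upJ g Rr nJr rmax.
Qed.

End MovingBullet.

(** * The half turn and the order of the labels *)

Section Reversal.
Local Open Scope ring_scope.
Implicit Types (R J : pred cell) (G : grid sym) (i a p q : int) (x y z r w : cell).

Definition rotc x : cell := (- x.1, - x.2).
Definition rots (u : sym) : sym :=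
  match u with inl r => inl (rotc r) | inr a => inr (- a) end.

Lemma rotcK : involutive rotc. Proof. by case=> a b; rewrite /rotc /= !opprK. Qed.
Lemma rotsK : involutive rots. Proof. by case=> [r|a] /=; rewrite ?rotcK ?opprK. Qed.

Lemma covers_rotc x y : covers x y -> covers (rotc y) (rotc x).
Proof. by case=> ->; [left|right]; apply: eq_cell => /=; lia. Qed.

Lemma le2_rotc x y : le2 (rotc x) (rotc y) <-> le2 y x.
Proof. by rewrite /le2 /=; lia. Qed.

(** Negating entries and exchanging passed with unpassed labels changes the sign of [cls], and the
    half turn changes that of [ht]. So [prec] is reversed exactly as [covers] is. *)
Lemma good_rot R J i G : good R J i G ->
  good (R \o rotc) (fun z => ~~ J (rotc z)) (- i) (conj rotc rots G).
Proof.
have T (o : option sym) v : omap rots o = Some v -> o = Some (rots v).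
  by case: o => //= a [<-]; rewrite rotsK.
move=> g; split.
- move=> x y z /le2_rotc l1 /le2_rotc l2; rewrite /conj => hx hz.
  have : G (rotc y) <> None.
    apply: (good_convex g l2 l1); first by case: (G _) hz.
    by case: (G _) hx.
  by case: (G _).
- by move=> x r /T/(good_label g).
- move=> r /(good_onto g)[x Gx]; exists (rotc x).
  by rewrite /conj rotcK Gx /= rotcK.
- move=> x y p p' q /T Gx /T Gy pp; have := good_col g Gy Gx.
  by rewrite /=; lia.
- move=> x y p q q' /T Gx /T Gy pp; have := good_row g Gy Gx.
  by rewrite /=; lia.
move=> x y u v c /T Gx /T Gy; have := good_strict g (covers_rotc c) Gy Gx.
clear; case: u v => [r|b] [r'|b']; rewrite /prec /=.
- by case: (J (rotc r)); case: (J (rotc r')) => /=; lia.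
- by case: (J (rotc r)) => /=; lia.
- by case: (J (rotc r')) => /=; lia.
- lia.
Qed.

(** Undoing a passage is a forward passage after the half turn: a minimal passed label becomes a
    maximal unpassed one, and switches commute with the half turn. *)
Lemma good_back R J i G r : rect R -> upper R J -> good R J i G ->
  R r -> J r -> (forall r', R r' -> le2 r' r -> r' = r \/ ~~ J r') ->
  good R (fun z => (z != r) && J z) i (sw (inl r) (inr i) G).
Proof.
move=> rectR upJ g Rr Jr rmin.
have E : sw (inl (rotc r)) (inr (- i)) (conj rotc rots G) =
         conj rotc rots (sw (inl r) (inr i) G).
  have cov x y : covers x y \/ covers y x ->
      covers (rotc x) (rotc y) \/ covers (rotc y) (rotc x).
    by move=> []/covers_rotc; [right|left].
  exact: (@sw_conj _ rotc rots (can_inj rotsK) cov rotcK (inl r) (inr i) G).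
have g2 : good (R \o rotc) (fun z => (z == rotc r) || ~~ J (rotc z)) (- i)
    (sw (inl (rotc r)) (inr (- i)) (conj rotc rots G)).
  apply: good_step (good_rot g) _ _ _.
  - by move=> ? ? ? ? h1 h2; exact: rectR h1 h2.
  - move=> r1 r2 R1 R2 nJ l; apply: contra nJ => J2.
    by apply: upJ J2 _ => //; apply/le2_rotc.
  - by rewrite /= rotcK.
  - by rewrite rotcK Jr.
  move=> r' Rr' l; have [||e|] := rmin (rotc r') => //; last by right.
    by apply/le2_rotc; rewrite rotcK.
  by left; rewrite -e rotcK.
have -> : sw (inl r) (inr i) G = conj rotc rots (sw (inl (rotc r)) (inr (- i)) (conj rotc rots G)).
  rewrite E; apply: functional_extensionality => x; rewrite /conj rotcK.
  by case: (sw _ _ _ _) => //= u; rewrite rotsK.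
have := good_rot g2; rewrite opprK.
have -> : (R \o rotc) \o rotc = R.
  by apply: functional_extensionality => z; rewrite /= rotcK.
suff -> : (fun z => ~~ ((rotc z == rotc r) || ~~ J (rotc (rotc z)))) =
  (fun z => (z != r) && J z) by [].
apply: functional_extensionality => z.
by rewrite rotcK negb_or negbK (inj_eq (can_inj rotcK)).
Qed.

Definition maximal R J r :=
  [/\ R r, ~~ J r & forall r', R r' -> le2 r r' -> r' = r \/ J r'].

Definition nb x y := covers x y \/ covers y x.

Lemma nb_sym x y : nb x y -> nb y x.
Proof. by case; [right|left]. Qed.

Definition exec i L G : grid sym := foldl (fun G r => sw (inl r) (inr i) G) G L.

Lemma exec_cat i L1 L2 G : exec i (L1 ++ L2) G = exec i L2 (exec i L1 G).
Proof. exact: foldl_cat. Qed.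

Lemma maximal_upper R J r : upper R J -> maximal R J r ->
  upper R (fun z => (z == r) || J z).
Proof.
move=> upJ [Rr nJ mr] r1 r2 R1 R2 /orP[/eqP e|J1] l; last by rewrite (upJ _ _ R1 R2 J1 l) orbT.
by subst r1; have [->|->] := mr _ R2 l; rewrite ?eqxx ?orbT.
Qed.

Lemma maximal_weak R J r r' : maximal R J r -> r' != r ->
  maximal R (fun z => (z == r') || J z) r.
Proof.
case=> Rr nJ mr ne; split => //; first by rewrite negb_or eq_sym ne.
by move=> r1 R1 /(mr _ R1)[->|->]; [left|right; rewrite orbT].
Qed.

(** * Independence of the labels that may be passed next *)

Section NonInteraction.
Variables (R J : pred cell) (i : int) (G : grid sym).
Hypotheses (rectR : rect R) (upJ : upper R J) (g : good R J i G).

Lemma maximal_apart x y r r' : nb x y -> G x = Some (inl r) -> G y = Some (inl r') ->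
  maximal R J r -> maximal R J r' -> False.
Proof.
have H x1 y1 r1 r2 : covers x1 y1 -> G x1 = Some (inl r1) -> G y1 = Some (inl r2) ->
    maximal R J r1 -> maximal R J r2 -> False.
  move=> c G1 G2 [R1 nJ1 m1] [R2 nJ2 m2].
  have e : r1 = r2.
    have [/(m1 _ R2)[->|J2]|/(m2 _ R1)[->|J1]] // := good_comparable rectR g (covers_le2 c) G1 G2.
      by rewrite J2 in nJ2.
    by rewrite J1 in nJ1.
  by subst r2; have := good_strict g c G1 G2 => /prec_irr.
by move=> [] c G1 G2 m1 m2; [exact: H c G1 G2 m1 m2|exact: H c G2 G1 m2 m1].
Qed.

Lemma bullet_before x y r : nb x y -> G x = Some (inr i) -> G y = Some (inl r) ->
  ~~ J r -> y = north x \/ y = west x.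
Proof.
move=> [] c Gx Gy nJ; last by case: (coversP c) => -[-> _]; [left|right].
have := good_strict g c Gx Gy; rewrite /prec /= (negbTE nJ); lia.
Qed.

(** Unpassed labels next to a bullet are north or west of it, where [good_fork] makes them
    comparable; comparable maximal labels coincide. *)
Lemma maximal_same x y y' r r' : nb x y -> nb x y' -> G x = Some (inr i) ->
  G y = Some (inl r) -> G y' = Some (inl r') ->
  maximal R J r -> maximal R J r' -> r = r'.
Proof.
have H z u v : G z = Some (inr i) -> G (north z) = Some (inl u) ->
    G (west z) = Some (inl v) -> maximal R J u -> maximal R J v -> u = v.
  move=> Gz Gu Gv [Ru nJu mu] [Rv nJv mv].
  case: (good_fork rectR g Gu Gv) => [/(mu _ Rv)[->//|Jv]|/(mv _ Ru)[->//|Ju]|[w]].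
  - by rewrite Jv in nJv.
  - by rewrite Ju in nJu.
  - by rewrite Gz.
move=> n n' Gx Gy Gy' m m'.
have [[_ nJ _] [_ nJ' _]] := (m, m').
case: (bullet_before n Gx Gy nJ) (bullet_before n' Gx Gy' nJ') => [] e [] e'; subst y y'.
- by move: Gy'; rewrite Gy => -[].
- exact: H Gx Gy Gy' m m'.
- by symmetry; exact: H Gx Gy' Gy m' m.
- by move: Gy'; rewrite Gy => -[].
Qed.

Lemma bullet_apart x y : nb x y -> G x = Some (inr i) -> G y = Some (inr i) -> False.
Proof.
by case=> c Gx Gy; [have := good_strict g c Gx Gy|have := good_strict g c Gy Gx] => /prec_irr.
Qed.

End NonInteraction.

(* The simultaneous switch of the bullets with all the labels in L; it does not
   depend on the order of L, which is how the order of the slides is eliminated. *)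
Record multiswitch i (L : seq cell) G G' : Prop := Multiswitch {
  ms_fill : forall x y r, G x = Some (inr i) -> nb x y -> G y = Some (inl r) ->
    r \in L -> G' x = Some (inl r);
  ms_stay : forall x, G x = Some (inr i) ->
    (forall y r, nb x y -> G y = Some (inl r) -> r \notin L) -> G' x = Some (inr i);
  ms_free : forall x y r, G x = Some (inl r) -> r \in L -> nb x y ->
    G y = Some (inr i) -> G' x = Some (inr i);
  ms_keep : forall x r, G x = Some (inl r) -> r \in L ->
    (forall y, nb x y -> G y <> Some (inr i)) -> G' x = Some (inl r);
  ms_off : forall x, G x <> Some (inr i) ->
    (forall r, r \in L -> G x <> Some (inl r)) -> G' x = G x }.

Lemma multiswitch_sub i L1 L2 G G' : L1 =i L2 ->
  multiswitch i L1 G G' -> multiswitch i L2 G G'.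
Proof.
move=> e [h1 h2 h3 h4 h5]; split.
- by move=> x y r Gx n Gy rL; apply: h1 Gx n Gy _; rewrite e.
- by move=> x Gx H; apply: h2 Gx _ => y r n Gy; rewrite e; apply: H n Gy.
- by move=> x y r Gx rL n Gy; apply: h3 Gx _ n Gy; rewrite e.
- by move=> x r Gx rL H; apply: h4 Gx _ H; rewrite e.
- by move=> x Gx H; apply: h5 Gx _ => r; rewrite e; apply: H.
Qed.

Lemma multiswitch_uniq i L G G1 G2 : multiswitch i L G G1 ->
  multiswitch i L G G2 -> G1 = G2.
Proof.
move=> [a1 a2 a3 a4 a5] [b1 b2 b3 b4 b5]; apply: functional_extensionality => x.
case: (G x =P Some (inr i)) => [Gx|nt].
  case: (classic (exists y r, [/\ nb x y, G y = Some (inl r) & r \in L])).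
    by move=> [y [r [n Gy rL]]]; rewrite (a1 x y r) // (b1 x y r).
  move=> H; have H' y r : nb x y -> G y = Some (inl r) -> r \notin L.
    by move=> n Gy; apply/negP => rL; apply: H; exists y, r.
  by rewrite a2 ?b2.
case: (classic (exists2 r, r \in L & G x = Some (inl r))) => [[r rL Gx]|H].
  case: (classic (exists2 y, nb x y & G y = Some (inr i))) => [[y n Gy]|H].
    by rewrite (a3 x y r) // (b3 x y r).
  have H' y : nb x y -> G y <> Some (inr i) by move=> n Gy; apply: H; exists y.
  by rewrite (a4 x r) // (b4 x r).
have H' r : r \in L -> G x <> Some (inl r) by move=> rL Gx; apply: H; exists r.
by rewrite a5 ?b5.
Qed.

Lemma multiswitch1 R J i G r : good R J i G -> ~~ J r ->
  multiswitch i [:: r] G (sw (inl r) (inr i) G).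
Proof.
move=> g nJ.
have on_t y : G y = Some (inr i) -> on (inl r) (inr i) (G y).
  by move=> ->; rewrite /on eqxx orbT.
have on_r y : G y = Some (inl r) -> on (inl r) (inr i) (G y).
  by move=> ->; rewrite /on eqxx.
split.
- move=> x y r0 Gx n Gy; rewrite inE => /eqP e; subst r0.
  rewrite /sw on_t //= (_ : touched _ _ _ _) ?Gx //.
  by apply/touchedP; exists y => //; apply: on_r.
- move=> x Gx H; rewrite /sw on_t //=.
  case: touchedP => [[y n ony]|]; last by rewrite Gx.
  case/orP: ony => /eqP Gy; first by have := H _ _ n Gy; rewrite inE eqxx.
  by case: (bullet_apart g n Gx Gy).
- move=> x y r0 Gx; rewrite inE => /eqP e n Gy; subst r0.
  rewrite /sw on_r //= (_ : touched _ _ _ _) ?Gx ?eqxx //.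
  by apply/touchedP; exists y => //; apply: on_t.
- move=> x r0 Gx; rewrite inE => /eqP e H; subst r0.
  rewrite /sw on_r //=.
  case: touchedP => [[y n ony]|]; last by rewrite Gx.
  case/orP: ony => /eqP Gy; last by case: (H _ n Gy).
  by case: n => c; [have := good_strict g c Gx Gy|have := good_strict g c Gy Gx] => /prec_irr.
move=> x nt H; apply: sw_off; rewrite negb_or; apply/andP; split; apply/eqP => //.
by apply: H; rewrite inE.
Qed.

(** Passing [r] leaves the surroundings of the labels in [L] intact: by [maximal_same] their bullets
    are not next to [r], and by [maximal_apart] a bullet that takes the place of [r] does not touch
    them. *)
Lemma multiswitch_cons R J i G r L G2 : rect R -> upper R J -> good R J i G ->
  (forall r', r' \in r :: L -> maximal R J r') -> r \notin L ->
  multiswitch i L (sw (inl r) (inr i) G) G2 -> multiswitch i (r :: L) G G2.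
Proof.
move=> rectR upJ g mx rL; have mr : maximal R J r by apply: mx; rewrite inE eqxx.
have [Rr nJr _] := mr.
have rr : r \in [:: r] by rewrite inE.
have mL r' : r' \in L -> maximal R J r' by move=> h; apply: mx; rewrite inE h orbT.
have [a1 a2 a3 a4 a5] := multiswitch1 g nJr.
set G1 := sw _ _ G in a1 a2 a3 a4 a5 * => -[b1 b2 b3 b4 b5].
have neL r' : r' \in L -> r' <> r by move=> h e; move: rL; rewrite -e h.
have keepL x r' : r' \in L -> G x = Some (inl r') -> G1 x = Some (inl r').
  move=> h Gx; rewrite a5 Gx // => r0; rewrite inE => /eqP-> [].
  exact: neL.
have backL x r' : r' \in L -> G1 x = Some (inl r') -> G x = Some (inl r').
  by move=> h /sw_src[//|[]/(neL _ h)|].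
have keept x : G x = Some (inr i) ->
    (exists y r', [/\ nb x y, G y = Some (inl r') & r' \in L]) -> G1 x = Some (inr i).
  move=> Gx [y [r' [n Gy r'L]]]; apply: a2 => // y' r0 n' Gy'; rewrite inE.
  apply/eqP => e; subst r0; apply: (neL _ r'L).
  exact: (maximal_same rectR g n n' Gx Gy Gy' (mL _ r'L) mr).
split.
- move=> x y r0 Gx n Gy; rewrite inE => /orP[/eqP e|r0L].
    subst r0; have G1x : G1 x = Some (inl r) by apply: (a1 x y r).
    by rewrite b5 G1x // => r0 r0L [e]; case: (neL _ r0L).
  have G1x : G1 x = Some (inr i) by apply: keept => //; exists y, r0.
  by apply: (b1 x y r0) => //; exact: keepL.
- move=> x Gx H; apply: b2.
    by apply: a2 => // y r0 n Gy; have := H _ _ n Gy; rewrite !inE negb_or => /andP[].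
  move=> y r0 n G1y; apply/negP => r0L.
  by have := H _ _ n (backL _ _ r0L G1y); rewrite inE r0L orbT.
- move=> x y r0 Gx; rewrite inE => /orP[/eqP e|r0L] n Gy.
    subst r0; apply: b2; first exact: (a3 x y r).
    move=> y' r0 n' G1y'; apply/negP => r0L.
    exact: (maximal_apart rectR g n' Gx (backL _ _ r0L G1y') mr (mL _ r0L)).
  apply: (b3 x y r0) => //; first exact: keepL.
  by apply: keept => //; exists x, r0; split => //; exact: nb_sym.
- move=> x r0 Gx; rewrite inE => /orP[/eqP e|r0L] H.
    subst r0; have G1x : G1 x = Some (inl r) by apply: a4.
    by rewrite b5 G1x // => r0 r0L [e]; case: (neL _ r0L).
  apply: b4 => //; first exact: keepL.
  move=> y n /(swP g Rr nJr)[Gy nr nt|//|_ Gy _|//|y' _ Gy _ _].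
  - exact: H n Gy.
  - exact: H n Gy.
  exact: (maximal_apart rectR g n Gx Gy (mL _ r0L) mr).
move=> x nt H; have e : G1 x = G x.
  by apply: a5 => // r0; rewrite inE => /eqP->; apply: H; rewrite inE eqxx.
by rewrite b5 e // => r0 r0L; apply: H; rewrite inE r0L orbT.
Qed.

(** Such an [L] is an initial part of a linear extension of the reversed order on the labels of [R]
    outside [J]. *)
Fixpoint descending R J (L : seq cell) : Prop :=
  if L is r :: L' then maximal R J r /\ descending R (fun z => (z == r) || J z) L'
  else True.

Definition adjoin J (L : seq cell) : pred cell := fun z => (z \in L) || J z.

Lemma adjoin_cons J r L : adjoin (fun z => (z == r) || J z) L = adjoin J (r :: L).
Proof.
by apply: functional_extensionality => z; rewrite /adjoin inE orbCA orbA.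
Qed.

Lemma exec_good R i L : rect R -> forall J G, upper R J -> good R J i G ->
  descending R J L -> good R (adjoin J L) i (exec i L G) /\ upper R (adjoin J L).
Proof.
move=> rectR; elim: L => [|r L IH] J G upJ g /=; first by [].
move=> [m d]; have [Rr nJ mr] := m; rewrite -adjoin_cons; apply: IH d.
  exact: maximal_upper.
exact: good_step.
Qed.

Lemma exec_multiswitch R i L : rect R -> forall J G, upper R J -> good R J i G ->
  uniq L -> (forall r, r \in L -> maximal R J r) ->
  multiswitch i L G (exec i L G).
Proof.
move=> rectR; elim: L => [|r L IH] J G upJ g.
  by split => // ? ?; rewrite ?in_nil.
move=> /= /andP[rL uL] mx; have mr : maximal R J r by apply: mx; rewrite inE eqxx.
have [Rr nJ mr'] := mr.
apply: (multiswitch_cons rectR upJ g mx rL).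
apply: (IH (fun z => (z == r) || J z)) => //.
- exact: maximal_upper.
- exact: good_step.
move=> r' h; apply: maximal_weak; first by apply: mx; rewrite inE h orbT.
by apply: contraNneq rL => ->.
Qed.

Lemma exec_swap R J i G r1 r2 : rect R -> upper R J -> good R J i G ->
  maximal R J r1 -> maximal R J r2 -> r1 != r2 ->
  exec i [:: r1; r2] G = exec i [:: r2; r1] G.
Proof.
move=> rectR upJ g m1 m2 ne.
have mx (L : seq cell) : {subset L <= [:: r1; r2]} -> forall r, r \in L -> maximal R J r.
  by move=> s r /s; rewrite !inE => /orP[]/eqP->.
have ms1 : multiswitch i [:: r1; r2] G (exec i [:: r1; r2] G).
  by apply: (exec_multiswitch rectR upJ g); [rewrite /= inE ne|exact: mx].
have ms2 : multiswitch i [:: r2; r1] G (exec i [:: r2; r1] G).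
  apply: (exec_multiswitch rectR upJ g); first by rewrite /= inE eq_sym ne.
  by apply: mx => r; rewrite !inE orbC.
apply: multiswitch_uniq ms1 _; apply: multiswitch_sub ms2.
by move=> r; rewrite !inE orbC.
Qed.

(** A label that is maximal from the start stays so while others are passed, so it can be exchanged
    with each of its predecessors in turn. *)
Lemma descending_front R i L1 r L2 : rect R -> forall J G, upper R J -> good R J i G ->
  descending R J (L1 ++ r :: L2) -> maximal R J r -> r \notin L1 ->
  exec i (L1 ++ r :: L2) G = exec i (r :: L1 ++ L2) G /\
  descending R J (r :: L1 ++ L2).
Proof.
move=> rectR; elim: L1 => [|a L1 IH] J G upJ g //.
rewrite [_ ++ _]/= [descending _ _ _]/= inE negb_or => -[ma d] mr /andP[ra rL1].
have upa := maximal_upper upJ ma.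
have [Ra nJa xa] := ma.
have ga := good_step rectR upJ g Ra nJa xa.
have ar : a != r by rewrite eq_sym.
have mra := maximal_weak mr ar.
have [E d'] := IH _ _ upa ga d mra rL1.
split.
  have /= E' := exec_swap rectR upJ g ma mr ar.
  by rewrite /= in E *; rewrite E E'.
split => //; split; first exact: maximal_weak.
case: d' => _; rewrite -/descending; set J1 := fun z => _; set J2 := fun z => _.
by rewrite (_ : J1 = J2) //; apply: functional_extensionality => z; rewrite /J1 /J2 orbCA.
Qed.

(** The head of [L1] is maximal at the start, so it can be brought to the front of [L2]; the tails
    are then linear extensions of the same remaining labels. *)
Lemma exec_perm R i L1 : rect R -> forall L2 J G, upper R J -> good R J i G ->
  descending R J L1 -> descending R J L2 -> perm_eq L1 L2 -> uniq L1 ->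
  exec i L1 G = exec i L2 G.
Proof.
move=> rectR; elim: L1 => [|r L1 IH] L2 J G upJ g d1 d2 p.
  by move: p; rewrite perm_sym => /perm_nilP->.
have rL2 : r \in L2 by rewrite -(perm_mem p) inE eqxx.
case/splitPr: rL2 d2 p => u v d2 p /= /andP[rL uL].
have p' : perm_eq L1 (u ++ v) 
  by move: p; rewrite perm_sym -[r :: v]cat1s perm_catCA /= perm_cons perm_sym.
have [m d1'] := d1; have [Rr nJ mr] := m.
have ru : r \notin u.
  by apply: contra rL; rewrite (perm_mem p') mem_cat => ->.
have [-> [_ d2']] := descending_front rectR upJ g d2 m ru.
apply: IH d1' d2' p' uL; first exact: maximal_upper.
exact: good_step.
Qed.

Lemma exec_back R i L : rect R -> forall J G, upper R J -> descending R J L ->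
  good R (adjoin J L) i G -> good R J i (exec i (rev L) G).
Proof.
move=> rectR; elim: L => [|r L IH] J G upJ; first by [].
move=> [m d] g; have [Rr nJ mr] := m.
rewrite rev_cons -cats1 exec_cat /=.
have upr := maximal_upper upJ m.
have g' := IH _ G upr d; rewrite adjoin_cons in g'; move/(_ g) in g'.
have -> : J = fun z => (z != r) && ((z == r) || J z).
  by apply: functional_extensionality => z; case: eqP => // ->; rewrite (negbTE nJ).
apply: good_back => //; first by rewrite eqxx.
move=> r' Rr' l; case: eqP => [e|_]; [by left|right].
by apply: contra nJ => Jr'; exact: upJ Jr' l.
Qed.

End Reversal.

(** * From slides to entries *)

Section Exchange.
Variable A : eqType.

Definition sws (l : seq (A * A)) (G : grid A) := foldl (fun G p => sw p.1 p.2 G) G l.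

Lemma sws_cat l1 l2 G : sws (l1 ++ l2) G = sws l2 (sws l1 G).
Proof. exact: foldl_cat. Qed.

Lemma sws_rev l G : all (fun p => p.1 != p.2) l -> sws (rev l) (sws l G) = G.
Proof.
elim: l G => //= p l IH G /andP[ne al].
by rewrite rev_cons -cats1 sws_cat IH //= swK.
Qed.

Definition separate (p q : A * A) :=
  [&& p.1 != q.1, p.1 != q.2, p.2 != q.1 & p.2 != q.2].

Lemma sws_comm l1 l2 G : all (fun p => all (separate p) l2) l1 ->
  sws l1 (sws l2 G) = sws l2 (sws l1 G).
Proof.
have one p l G0 : all (separate p) l -> sws l (sw p.1 p.2 G0) = sw p.1 p.2 (sws l G0).
  elim: l G0 => //= q l IH G0 /andP[/and4P[a b c d] al].
  by rewrite -IH // [in RHS]sw_comm.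
elim: l1 G => //= p l1 IH G /andP[sp al].
by rewrite -one // IH.
Qed.

(** Two steps are interchanged only if they differ both in [k] and in [i]; steps that share a symbol
    keep their relative order. *)
Lemma sws_exchange (ks is' : seq A) G : uniq ks -> uniq is' ->
  {in ks & is', forall k i, k != i} ->
  sws [seq (k, i) | k <- ks, i <- is'] G = sws [seq (k, i) | i <- is', k <- ks] G.
Proof.
elim: ks is' G => [|k ks IH] is' G; first by elim: is' G => //= i l IHl G _ /andP[_ ul] _; rewrite -IHl.
move=> /= /andP[kks uks] uis ne.
rewrite sws_cat IH {IH} //; last by move=> a b ha hb; apply: ne; rewrite // inE ha orbT.
elim: is' G uis ne => //= i l IHl G /andP[il ul] ne.
have nei a : a \in k :: ks -> a != i by move=> ha; apply: ne; rewrite // inE eqxx.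
have nel : {in k :: ks & l, forall k i, k != i}.
  by move=> a b ha hb; apply: ne; rewrite // inE hb orbT.
rewrite [in RHS]sws_cat -IHl // sws_cat; congr (sws _ _); apply: sws_comm.
apply/allP => _ /mapP[a ha ->]; apply/allP => _ /mapP[j hj ->] /=.
rewrite /separate /=; apply/and4P; split.
- by apply: contraNneq kks => <-.
- by apply: nel; rewrite // inE ha orbT.
- by rewrite eq_sym; apply: nei; rewrite inE eqxx.
- by apply: contraNneq il => ->.
Qed.

End Exchange.

(** * One entry against the labels of a slide, and against all labels *)

Section Columns.
Local Open Scope ring_scope.
Implicit Types (R J : pred cell) (G : grid sym) (i a p q : int) (x y z r w : cell).

(** On labels of [R] and on entries, [cls] for [i] with all labels passed is [cls] for [i + 1] with
    none passed, shifted by 2. So the next entry can start. *)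
Lemma good_shift R J i G : (forall r, R r -> J r) ->
  good R J i G <-> good R pred0 (i + 1) G.
Proof.
move=> full.
have E u : (forall r, u = inl r -> R r) -> cls J i u = cls pred0 (i + 1) u + 2.
  by case: u => [r|a] H /=; [rewrite full; [|exact: H]|]; lia.
have P u v x y : (forall x r, G x = Some (inl r) -> R r) -> G x = Some u -> G y = Some v ->
    prec J i u v <-> prec pred0 (i + 1) u v.
  move=> lab Gx Gy.
  have Eu : cls J i u = _ := E u (fun r e => lab x r (etrans Gx (congr1 Some e))).
  have Ev : cls J i v = _ := E v (fun r e => lab y r (etrans Gy (congr1 Some e))).
  by rewrite /prec Eu Ev; lia.
split => -[h1 h2 h3 h4 h5 h6]; split => // x y u v c Gx Gy.
  by apply/(P u v x y) => //; apply: h6 c Gx Gy.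
by apply/(P u v x y) => //; apply: h6 c Gx Gy.
Qed.

Lemma descending_cat R J L1 L2 : descending R J L1 ->
  descending R (adjoin J L1) L2 -> descending R J (L1 ++ L2).
Proof.
elim: L1 J => //= r L1 IH J [m d] d2; split => //; apply: IH => //.
by rewrite adjoin_cons.
Qed.

Lemma descending_uniq R J L : descending R J L -> uniq L /\ (forall z, z \in L -> ~~ J z).
Proof.
elim: L J => //= r L IH J [[_ nJ _] /IH[u H]]; split.
  by rewrite u andbT; apply/negP => /H; rewrite eqxx.
by move=> z; rewrite inE => /orP[/eqP->//|/H]; rewrite negb_or => /andP[].
Qed.

Lemma descending_maximal R J L : uniq L -> (forall r, r \in L -> maximal R J r) ->
  descending R J L.
Proof.
elim: L J => //= r L IH J /andP[rL uL] mx; split; first by apply: mx; rewrite inE eqxx.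
apply: IH => // r' h; apply: maximal_weak; first by apply: mx; rewrite inE h orbT.
by apply: contraNneq rL => ->.
Qed.

(** These are the symbols of the actual slides: all corners chosen in one slide share its number. *)
Definition collapse (s : cell -> nat) G : grid (nat + int) := fun x =>
  omap (fun u : sym => match u with inl r => inl (s r) | inr a => inr a end) (G x).

(** Merging labels could create new adjacencies of equal symbols, but maximal labels are never
    adjacent, so the merged switch acts as the simultaneous switch of the labels in [L]. *)
Lemma collapse_level s k R J i G L : rect R -> upper R J -> good R J i G ->
  uniq L -> (forall r, r \in L -> maximal R J r) ->
  (forall r, R r -> (r \in L) = (s r == k)) ->
  sw (inl k) (inr i) (collapse s G) = collapse s (exec i L G).
Proof.
move=> rectR upJ g uL mx Lk; have ms := exec_multiswitch rectR upJ g uL mx.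
have onE y : on (inl k) (inr i) (collapse s G y) ->
    (exists2 r, r \in L & G y = Some (inl r)) \/ G y = Some (inr i).
  rewrite /collapse; case Gy: (G y) => [[r|a]|] /orP[]/eqP //= -[e].
    by left; exists r => //; rewrite Lk ?e // (good_label g Gy).
  by right; rewrite e.
have sL r : r \in L -> s r = k by move=> h; apply/eqP; rewrite -Lk //; case: (mx _ h).
apply: functional_extensionality => x; rewrite /sw.
case: ifP => [/andP[/onE onx /touchedP[y n /onE ony]]|].
  rewrite {1 2}/collapse; case: onx => [[r rL Gx]|Gx].
    case: ony => [[r' r'L Gy]|Gy].
      by case: (maximal_apart rectR g n Gx Gy (mx _ rL) (mx _ r'L)).
    by rewrite /collapse (ms_free ms Gx rL n Gy) Gx /= sL // eqxx.
  case: ony => [[r' r'L Gy]|Gy].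
    by rewrite /collapse (ms_fill ms Gx n Gy r'L) Gx /= sL.
  by case: (bullet_apart g n Gx Gy).
move=> off.
case: (boolP (on (inl k) (inr i) (collapse s G x))) off => [onx /=|noff _].
  case: touchedP => // nt _.
  have no y r : nb x y -> G y = Some (inl r) -> r \notin L.
    move=> n Gy; apply/negP => rL; apply: nt; exists y => //.
    by rewrite /collapse Gy /= sL // /on eqxx.
  case: (onE _ onx) => [[r rL Gx]|Gx].
    rewrite {1}/collapse Gx /collapse (ms_keep ms Gx rL) // => y n Gy.
    by apply: nt; exists y => //; rewrite /collapse Gy /on eqxx orbT.
  by rewrite {1}/collapse Gx /collapse (ms_stay ms Gx).
rewrite {2}/collapse (ms_off ms) //.
  by move=> Gx; move: noff; rewrite /collapse Gx /on eqxx orbT.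
by move=> r rL Gx; move: noff; rewrite /collapse Gx /= sL // /on eqxx.
Qed.

(** * The linear extension given by the slide numbers *)

Section SlideLevels.
Variables (Rs : seq cell) (s : cell -> nat).
Let R : pred cell := fun z => z \in Rs.
Hypotheses (rectR : rect R) (uRs : uniq Rs).
Hypothesis s_decr : forall r r', R r -> R r' -> le2 r r' -> r <> r' -> (s r' < s r)%N.

Definition level k := [seq r <- Rs | s r == k].
Definition levels k n := flatten [seq level j | j <- iota k n].

Let J k : pred cell := fun z => (z \in Rs) && (s z < k)%N.

Lemma upper_J k : upper R (J k).
Proof.
move=> r r' Rr Rr' /andP[_ sr] l; rewrite /J [_ \in _]Rr' /=.
by case: (r =P r') => [<-//|ne]; apply: ltn_trans (s_decr Rr Rr' l ne) sr.
Qed.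

Lemma level_maximal k r : r \in level k -> maximal R (J k) r.
Proof.
rewrite mem_filter => /andP[/eqP sr Rr]; split => //.
  by rewrite /J sr ltnn andbF.
move=> r' Rr' l; case: (r =P r') => [->|ne]; [by left|right].
by rewrite /J [_ \in _]Rr' -sr s_decr.
Qed.

Lemma adjoin_level k : adjoin (J k) (level k) = J k.+1.
Proof.
apply: functional_extensionality => z; rewrite /adjoin /J mem_filter ltnS [in RHS]leq_eqVlt.
by case: (z \in Rs); rewrite ?andbT ?andbF.
Qed.

Lemma level_descending k : descending R (J k) (level k).
Proof. by apply: descending_maximal (@level_maximal k); apply: filter_uniq. Qed.

Lemma levels_descending k n : descending R (J k) (levels k n).
Proof.
elim: n k => // n IH k; apply: descending_cat (level_descending k) _.
by rewrite adjoin_level; apply: IH.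
Qed.

Lemma levels_spec i n k G : good R (J k) i G ->
  collapse s (exec i (levels k n) G) =
    sws [seq (inl j, inr i) | j <- iota k n] (collapse s G).
Proof.
elim: n k G => [//|n IH] k G g.
have [g' _] := exec_good rectR (@upper_J k) g (level_descending k).
rewrite adjoin_level in g'; rewrite /levels /= -/(levels k.+1 n) exec_cat IH //.
rewrite (collapse_level (L := level k) (k := k) rectR (@upper_J k) g) //.
- exact: filter_uniq.
- exact: level_maximal.
by move=> r Rr; rewrite mem_filter [_ \in _]Rr andbT.
Qed.

Variable m : nat.
Hypothesis s_lt : forall r, R r -> (s r < m)%N.

Lemma J0 : J 0 = pred0.
Proof. by apply: functional_extensionality => z; rewrite /J ltn0 andbF. Qed.

Lemma levels_descending0 : descending R pred0 (levels 0 m).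
Proof. by rewrite -J0; apply: levels_descending. Qed.

Lemma levels_perm : perm_eq (levels 0 m) Rs.
Proof.
have [u _] := descending_uniq levels_descending0; apply: uniq_perm => // z; apply/flatten_mapP/idP => [[k _]|Rz].
  by rewrite mem_filter => /andP[].
by exists (s z); rewrite ?mem_iota ?s_lt // mem_filter eqxx.
Qed.

End SlideLevels.

(** * Passing the entries one after the other through a fixed linear extension *)

Section FullRuns.
Variables (Rs w : seq cell).
Let R : pred cell := fun z => z \in Rs.
Hypotheses (rectR : rect R) (uRs : uniq Rs).
Hypotheses (wd : descending R pred0 w) (wR : perm_eq w Rs).

Definition run (l : seq int) G := foldl (fun G i => exec i w G) G l.
Definition unrun (l : seq int) G := foldr (fun i G => exec i (rev w) G) G l.

Lemma upper0 : upper R pred0. Proof. by []. Qed.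

Definition ints (k n : nat) : seq int := [seq j%:Z | j <- iota k n].

Lemma full r : R r -> adjoin pred0 w r.
Proof. by move=> Rr; rewrite /adjoin (perm_mem wR) [_ \in _]Rr. Qed.

Lemma exec_column i G : good R pred0 i G -> good R pred0 (i + 1) (exec i w G).
Proof.
move=> g; have [g' _] := exec_good rectR upper0 g wd.
exact/(good_shift _ _ full).
Qed.

Lemma unexec_column i G : good R pred0 (i + 1) G -> good R pred0 i (exec i (rev w) G).
Proof.
move=> g; apply: exec_back rectR _ _ upper0 wd _.
exact/(good_shift _ _ full).
Qed.

Lemma run_good k n G : good R pred0 k%:Z G -> good R pred0 (k + n)%:Z (run (ints k n) G).
Proof.
elim: n k G => [|n IH] k G g; first by rewrite addn0.
rewrite -addSnnS; apply: IH; rewrite -addn1 PoszD; exact: exec_column.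
Qed.

Lemma unrun_good k n G : good R pred0 (k + n)%:Z G -> good R pred0 k%:Z (unrun (ints k n) G).
Proof.
elim: n k G => [|n IH] k G g; first by rewrite addn0 in g.
rewrite -addSnnS in g; apply: unexec_column.
by have := IH _ _ g; rewrite -addn1 PoszD.
Qed.

Lemma exec_sws i L G : exec i L G = sws [seq (inl r, inr i) | r <- L] G.
Proof. by elim: L G => //= r L IH G; rewrite -IH. Qed.

Lemma execK i L G : exec i (rev L) (exec i L G) = G.
Proof. by rewrite !exec_sws map_rev sws_rev // all_map; apply/allP. Qed.

Lemma runK l G : unrun l (run l G) = G.
Proof. by elim: l G => //= i l IH G; rewrite IH execK. Qed.

Lemma unrunK l G : run l (unrun l G) = G.
Proof.
by elim: l G => //= i l IH G; rewrite -[X in exec i X]revK execK IH.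
Qed.

(** The right side proceeds slide by slide. The left side passes entry after entry through the fixed
    list [w], and [s] enters only in the final renaming; the independence of the order rests on
    this. *)
Lemma run_collapse s m k n G : 
  (forall r r', R r -> R r' -> le2 r r' -> r <> r' -> (s r' < s r)%N) ->
  (forall r, R r -> (s r < m)%N) -> good R pred0 k%:Z G ->
  collapse s (run (ints k n) G) =
  sws [seq (inl j, inr i) | j <- iota 0 m, i <- ints k n] (collapse s G).
Proof.
move=> sd sm g.
pose ks := [seq inl j | j <- iota 0 m] : seq (nat + int)%type.
pose is' := [seq inr i | i <- ints k n] : seq (nat + int)%type.
have -> : [seq (inl j, inr i) | j <- iota 0 m, i <- ints k n] =
    [seq (c, d) | c <- ks, d <- is'].
  by rewrite /ks /is' allpairs_mapl allpairs_mapr.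
rewrite (@sws_exchange _ ks is'); first last.
- by move=> _ _ /mapP[j _ ->] /mapP[i _ ->].
- rewrite /is' /ints -map_comp map_inj_uniq ?iota_uniq // => x y [].
  exact: id.
- by rewrite /ks map_inj_uniq ?iota_uniq // => x y [].
rewrite {}/is' {}/ks.
elim: n k G g => //= n IH k G g.
rewrite sws_cat (IH _ (exec k%:Z w G)); last by rewrite -addn1 PoszD; apply: exec_column.
congr (sws _ _); rewrite -map_comp.
have gJ := g; rewrite -(J0 Rs s) in gJ.
have E := levels_spec rectR uRs sd m gJ.
have d := levels_descending0 uRs sd m.
have p := levels_perm uRs sd sm.
(* For a single entry the order by levels is replaced by [w], both being linear extensions of all
   labels. *)
rewrite -[RHS]E; congr (collapse s _); apply: (exec_perm rectR upper0 g wd) => //.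
- by rewrite (perm_trans wR) // perm_sym.
- by have [] := descending_uniq wd.
Qed.

End FullRuns.
End Columns.

(** * Slides of tableaux as switches on a grid *)

Section Link.
Local Open Scope fset_scope.
Local Open Scope fmap_scope.
Implicit Types (b c : box) (x y : cell) (T U : filling).

Definition of_box b : cell := (Posz b.1, Posz b.2).
Definition to_box x : option box :=
  if x is (Posz i, Posz j) then Some (i, j) else None.

Lemma of_boxK b : to_box (of_box b) = Some b. Proof. by case: b. Qed.

Lemma of_box_inj : injective of_box.
Proof. by move=> [a b] [a' b'] [-> ->]. Qed.

Lemma to_boxP x b : to_box x = Some b -> x = of_box b.
Proof. by case: x => [[i|i] [j|j]] //= [<-]. Qed.

Lemma nb_of_box b c : nb (of_box b) (of_box c) <-> adjacent b c.
Proof.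
case: b c => [i j] [i' j']; rewrite /nb /covers /adjacent /of_box /=; split.
  by move=> [[]|[]] [/eqP e1 /eqP e2]; move: e1 e2; lia.
move=> h; case/orP: h => /andP[/eqP e /orP[]/eqP e'].
- by left; right; apply: eq_cell => /=; lia.
- by right; right; apply: eq_cell => /=; lia.
- by left; left; apply: eq_cell => /=; lia.
- by right; left; apply: eq_cell => /=; lia.
Qed.

Definition gridof (f : box -> option nat) : grid nat := fun x => obind f (to_box x).

Lemma gridof_box f b : gridof f (of_box b) = f b.
Proof. by rewrite /gridof of_boxK. Qed.

Lemma adjacent_irr b : adjacent b b = false.
Proof. by case: b => i j; rewrite /adjacent /= !eqxx /= !gtn_eqF. Qed.

Lemma component_gt1 (D : {fset box}) (A : pred D) (u : D) : A u ->
  (1 < #|component A u|) = [exists v, A v && adjacent (val u) (val v)].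
Proof.
move=> Au; apply/card_gt1P/existsP => [[v [w [cv cw ne]]]|[v /andP[Av uv]]].
  have step z : z \in component A u -> z != u -> exists v0, A v0 && adjacent (val u) (val v0).
    rewrite inE => /connectP[[|v0 p] /=]; first by move=> _ ->; rewrite eqxx.
    by move=> /andP[/and3P[_ Av0 uv0] _] _ _; exists v0; rewrite Av0.
  case: (v =P u) => [e|/eqP ne']; last exact: step cv ne'.
  by apply: step cw _; rewrite -e eq_sym.
exists u, v; split; rewrite ?inE ?connect0 //.
  by apply: connect1; rewrite /= Au Av.
by apply: contraTneq uv => <-; rewrite adjacent_irr.
Qed.

Lemma gridof_switch s t U :
  gridof (fnd (switch s t U)) = sw s t (gridof (fnd U)).
Proof.
apply: functional_extensionality => x.
case xb: (to_box x) => [b|]; last first.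
  have e0 : gridof (fnd U) x = None by rewrite /gridof xb.
  by rewrite [LHS]/gridof xb sw_off // e0.
rewrite (to_boxP xb) gridof_box.
case: (boolP (b \in domf U)) => [bU|nbU]; last first.
  have e0 : gridof (fnd U) (of_box b) = None by rewrite gridof_box not_fnd.
  by rewrite sw_off ?e0 // not_fnd.
pose A : pred (domf U) := fun v => (U v == s) || (U v == t).
have onA v : on s t (gridof (fnd U) (of_box (val v))) = A v.
  have e : [` fsvalP v] = v by apply: val_inj.
  by rewrite gridof_box /A (in_fnd (fsvalP v)) e /on !(inj_eq (@Some_inj _)).
have sE : (switch s t U).[? b] =
    if A [` bU] && (1 < #|component A [` bU]|) then
      if U.[bU] == s then Some t else Some s else Some U.[bU].
  rewrite (@in_fnd _ _ (switch s t U) b bU) ffunE -/A.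
  by case: ifP => // _; case: ifP.
rewrite {}sE /sw gridof_box (in_fnd bU).
have -> : on s t (Some U.[bU]) = A [` bU] by rewrite -onA gridof_box /= in_fnd.
case: (boolP (A _)) => // Ab; rewrite component_gt1 //=.
have -> : touched s t (gridof (fnd U)) (of_box b) = [exists v, A v && adjacent b (val v)].
  apply/touchedP/existsP => [[y n ony]|[v /andP[Av bv]]]; last first.
    by exists (of_box (val v)); [exact/nb_of_box|rewrite onA].
  case yc: (to_box y) => [c|]; last by move: ony; rewrite /gridof yc.
  have e := to_boxP yc; subst y.
  case: (boolP (c \in domf U)) => [cU|ncU]; last first.
    by move: ony; rewrite gridof_box not_fnd.
  exists [` cU]; rewrite -onA /= ony /=; exact/nb_of_box.
by case: ifP => // _; rewrite (inj_eq (@Some_inj _)).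
Qed.

Definition nsym := (nat + int)%type.
Implicit Types G : grid nsym.

Definition label_of (A : Type) (o : option (A + int)) : option nat :=
  if o is Some (inr (Posz a)) then Some a else None.

(** During slide [k], boxes labelled with a smaller number have been erased and those with a larger
    number still belong to the inner shape, so both are absent from the filling. *)
Definition with_bullet (k : nat) (o : option nsym) : option nat :=
  match o with
  | Some (inl j) => if j == k then Some bullet else None
  | Some (inr (Posz a)) => Some a
  | _ => None
  end.

Definition bounded (A : Type) (M : nat) (G : grid (A + int)) : Prop :=
  forall x a, G x = Some (inr a) -> (1 <= a <= Posz M)%R.

Lemma bounded_sw (A : eqType) M (u : A) (i : int) (G : grid (A + int)%type) :
  bounded M G -> (1 <= i <= Posz M)%R -> bounded M (sw (inl u) (inr i) G).
Proof. by move=> bG iM x a /sw_src[/bG|//|[->]]. Qed.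

Definition steps (k j n : nat) : seq (nsym * nsym) := [seq (inl k, inr i) | i <- ints j n].

Lemma steps_bounded k j n M G : bounded M G -> 1 <= j -> j + n <= M.+1 ->
  bounded M (sws (steps k j n) G).
Proof.
elim: n j G => //= n IH j G bG j1 jn; apply: IH; rewrite ?addSnnS //.
by apply: bounded_sw => //; lia.
Qed.

Lemma switches_sws k j n M U G : bounded M G -> 1 <= j -> j + n <= M.+1 ->
  gridof (fnd U) = (fun x => with_bullet k (G x)) ->
  gridof (fnd (foldl (fun U i => switch bullet i U) U (iota j n))) =
    (fun x => with_bullet k (sws (steps k j n) G x)).
Proof.
elim: n j U G => //= n IH j U G bG j1 jn E; apply: IH; rewrite ?addSnnS //.
  by apply: bounded_sw => //; lia.
rewrite gridof_switch E; apply: sw_map => //=.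
- move=> x; case Gx: (G x) => [[l|[a|a]]|] //=.
    by case: (l =P k) => [->|ne]; [rewrite !eqxx|apply/esym/eqP => -[]].
  (* Entries are positive, so none is mistaken for the bullet 0. *)
  have := bG _ _ Gx => h; apply/eqP => -[e]; move: h; rewrite e /bullet; lia.
- move=> x; case Gx: (G x) => [[l|[a|a]]|] //=; case: (l =P k) => //= _.
  by apply/eqP => -[e]; move: j1; rewrite -e.
- by rewrite eqxx.
Qed.

(* inl k comes just after the entries at most i, as these have been switched with
   it; inl j has been switched with all the entries if j < k, with none if j > k. *)
Definition rank (k i : nat) (u : nsym) : int * int :=
  match u with
  | inl j => if j < k then (1%R, (- Posz j)%R)
             else if j == k then (0%R, (Posz i.*2.+1)) else ((-1)%R, (- Posz j)%R)
  | inr a => (0%R, (a * 2)%R)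
  end.

Definition before k i (u v : nsym) : Prop :=
  ((rank k i u).1 < (rank k i v).1 \/
   (rank k i u).1 = (rank k i v).1 /\ (rank k i u).2 < (rank k i v).2)%R.

(** The purpose is to keep cells labelled [k] from being adjacent. A slide stops at the largest
    entry of its tableau, whereas on the grid all slides run up to a common [M], and two adjacent
    cells labelled [k] would be changed by a switch with an absent entry. *)
Definition increasing k i G : Prop :=
  forall x y u v, covers x y -> G x = Some u -> G y = Some v -> before k i u v.

(** The label [k] and the entry [i.+1] are consecutive in the order, the label first before the
    switch and last after it, so no other symbol changes its comparison with them. *)
Lemma increasing_sw k i G : increasing k i G ->
  increasing k i.+1 (sw (inl k) (inr (Posz i.+1)) G).
Proof.
set s : nsym := inl k; set t : nsym := inr _ => iG x y u v c.
have onP o : on s t o -> o = Some s \/ o = Some t by case/orP => /eqP; [left|right].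
have in_s u1 v1 : u1 <> s -> u1 <> t -> v1 = s \/ v1 = t ->
    (before k i u1 v1 -> forall w, w = s \/ w = t -> before k i.+1 u1 w) /\
    (before k i v1 u1 -> forall w, w = s \/ w = t -> before k i.+1 w u1).
  rewrite /before /s /t; case: u1 => [j|a] ns nt hv.
    have {ns nt} ne : j != k by apply: contra_notN ns => /eqP->.
    by split=> h w hw; move: h; case: hv => ->; case: hw => ->; rewrite /= ?ltnn ?eqxx (negbTE ne); case: ifP => _ /=; lia.
  have {ns nt} ne : a <> Posz i.+1 by move=> e; apply: nt; rewrite e.
  by split=> h w hw; move: h; case: hv => ->; case: hw => ->; rewrite /= ?ltnn ?eqxx /=; lia.
have E z w : sw s t G z = Some w ->
    (G z = Some w /\ w <> s /\ w <> t) \/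
    ((w = s \/ w = t) /\ exists2 w', w' = s \/ w' = t & G z = Some w').
  move=> Gz; case: (boolP (on s t (G z))) => o; last first.
    left; rewrite sw_off // in Gz; split => //; move: o; rewrite Gz negb_or.
    by move=> /andP[/eqP n1 /eqP n2]; split=> e; [apply: n1|apply: n2]; rewrite e.
  right; have := o; rewrite -(on_sw s t G z) Gz => /onP h; split.
    by case: h => -[->]; [left|right].
  by case: (onP _ o) => ->; [exists s; [left|]|exists t; [right|]].
move=> swx swy; have [[Gx [ns nt]]|[hu [u1 hu1 Gx]]] := E _ _ swx;
  have [[Gy [ns' nt']]|[hv [v1 hv1 Gy]]] := E _ _ swy.
- have := iG _ _ _ _ c Gx Gy; rewrite /before.
  have O w : w <> s -> w <> t -> rank k i.+1 w = rank k i w.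
    by case: w => [j|a] //= n1 _; case: (j =P k) => // e; case: n1; rewrite e.
  by rewrite !O.
- exact: (in_s u v1 ns nt hv1).1 (iG _ _ _ _ c Gx Gy) v hv.
- exact: (in_s v u1 ns' nt' hu1).2 (iG _ _ _ _ c Gx Gy) u hu.
(* In the remaining case the label is followed by the entry in adjacent cells; both are touched,
   hence interchanged. *)
have [e1 e2] : u1 = s /\ v1 = t.
  have := iG _ _ _ _ c Gx Gy; rewrite /before.
  by case: hu1 => ->; case: hv1 => ->; rewrite /= ?ltnn ?eqxx /=; [lia|split|lia|lia].
subst u1 v1; have st : s != t by [].
have on_s z : G z = Some s -> on s t (G z) by move=> ->; rewrite /on eqxx.
have on_t z : G z = Some t -> on s t (G z) by move=> ->; rewrite /on eqxx orbT.
have tx : touched s t G x by apply/touchedP; exists y; [left|exact: on_t].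
have ty : touched s t G y by apply/touchedP; exists x; [right|exact: on_s].
move: swx; rewrite /sw (on_s x) // tx Gx eqxx /= => -[<-].
move: swy; rewrite /sw (on_t y) // ty Gy (inj_eq (@Some_inj _)) eq_sym (negbTE st) => -[<-].
by rewrite /before /= ltnn eqxx /=; lia.
Qed.

Lemma increasing_steps k i n G : increasing k i G ->
  increasing k (i + n) (sws (steps k i.+1 n) G).
Proof.
elim: n i G => [|n IH] i G iG; first by rewrite addn0.
by rewrite -addSnnS; apply: IH; apply: increasing_sw.
Qed.

(** All entries lie between 1 and [M], so in both rankings the label [k] is after every entry and
    [k.+1] before every entry: the two orders coincide. *)
Lemma increasing_next k M G : bounded M G -> increasing k M G -> increasing k.+1 0 G.
Proof.
move=> bG iG x y u v c Gx Gy; have := iG _ _ _ _ c Gx Gy.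
have bu a : u = inr a -> (1 <= a <= Posz M)%R by move=> e; apply: (bG x); rewrite Gx e.
have bv a : v = inr a -> (1 <= a <= Posz M)%R by move=> e; apply: (bG y); rewrite Gy e.
rewrite /before; case: u v bu bv {Gx Gy} => [j|a] [j'|a'] bu bv; rewrite /=.
- by do 2?[case: ltngtP => ? /=]; do 2?[case: ltngtP => ? /=]; lia.
- by have := bv _ erefl; do 2?[case: ltngtP => ? /=]; lia.
- by have := bu _ erefl; do 2?[case: ltngtP => ? /=]; lia.
- lia.
Qed.

Lemma sw_absent k i G : (forall x, G x <> Some (inr i)) ->
  (forall x y, covers x y -> G x = Some (inl k) -> G y <> Some (inl k)) ->
  sw (inl k) (inr i) G = G.
Proof.
move=> ni nk; apply: functional_extensionality => x; rewrite /sw.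
case: ifP => // /andP[/orP[]/eqP Gx]; last by case: (ni x).
move=> /touchedP[y [] c /orP[]/eqP Gy]; try by case: (ni y).
  by case: (nk _ _ c Gx).
by case: (nk _ _ c Gy).
Qed.

Lemma steps_absent k j n M G : bounded M G -> M < j ->
  (forall x y, covers x y -> G x = Some (inl k) -> G y <> Some (inl k)) ->
  sws (steps k j n) G = G.
Proof.
elim: n j => //= n IH j bG Mj nk; rewrite sw_absent ?IH //; first exact: ltnW.
by move=> x /bG; lia.
Qed.

Lemma steps_cat k j m n : steps k j (m + n) = steps k j m ++ steps k (j + m) n.
Proof. by rewrite /steps /ints iotaD !map_cat. Qed.

Lemma Kjdt_link k M (X : {fset box}) T G : bounded M G -> increasing k 0 G ->
  (forall b, (b \in X) = (G (of_box b) == Some (inl k))) ->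
  (forall x, G x <> None -> to_box x <> None) ->
  gridof (fnd T) = (fun x => label_of (G x)) ->
  gridof (fnd (Kjdt T X)) = (fun x => label_of (sws (steps k 1 M) G x)).
Proof.
move=> bG iG XG quart TG; set m := max_entry T.
have Tb b : T.[? b] = label_of (G (of_box b)) by rewrite -[LHS]gridof_box TG.
(* The entries of [G] are those of [T], so the largest entry of [T] bounds them as well. *)
have bm : bounded m G.
  move=> x a Gx; have /andP[a1 aM] := bG _ _ Gx.
  case xb: (to_box x) => [b|]; last by case: (quart x) => //; rewrite Gx.
  case: a Gx a1 aM => // a Gx a1 aM.
  have := Tb b; rewrite -(to_boxP xb) Gx /=; case: fndP => // bT [e].
  have : a <= m by rewrite -e /m /max_entry (leq_bigmax (F := fun x : domf T => T x)).
  by rewrite a1; lia.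
have mM : m <= M.
  apply/bigmax_leqP => b _; have := Tb (val b); rewrite (in_fnd (fsvalP b)).
  case Gb: (G _) => [[j|[a|a]]|] //= -[e]; have := bG _ _ Gb.
  have -> : T b = a by rewrite -e; congr (T _); apply: val_inj.
  lia.
have st0 : gridof (fnd (place_bullets X T)) = (fun x => with_bullet k (G x)).
  apply: functional_extensionality => x; case xb: (to_box x) => [b|]; last first.
    rewrite /gridof xb; case Gx : (G x) => [u|] //.
    by case: (quart x) => //; rewrite Gx.
  rewrite (to_boxP xb) gridof_box /place_bullets fnd_cat.
  case: ifP => /= [bX|nbX].
    by rewrite (in_fnd bX) ffunE; have := XG b; rewrite bX => /esym/eqP->/=; rewrite eqxx.
  rewrite Tb; have := XG b; rewrite nbX; case: (G _) => [[j|a]|] //=.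
  by case: (j =P k) => // -> /esym/eqP[].
have E := switches_sws bm (leqnn 1) (leqnn _) st0.
have nk : forall x y, covers x y -> sws (steps k 1 m) G x = Some (inl k) ->
    sws (steps k 1 m) G y <> Some (inl k).
  have inc : increasing k m (sws (steps k 1 m) G) by apply: (@increasing_steps _ 0).
  move=> x y c h1 h2; have := inc _ _ _ _ c h1 h2.
  by rewrite /before; lia.
(* The steps with entries above [m] change nothing, because adjacent cells never both carry [k]. *)
have -> : M = (m + (M - m))%N by rewrite subnKC.
have bm' := steps_bounded (k := k) bm (leqnn 1) (leqnn _ : (1 + m <= m.+1)%N).
rewrite steps_cat sws_cat (@steps_absent k (1 + m)%N _ m _ bm' _ nk) //.
apply: functional_extensionality => x; have := congr1 (fun g => g x) E.
rewrite /gridof; case: (to_box x) => [b|] /=; last first.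
  by case Gx: (sws _ _ x) => [[j|[a|a]]|] //=.
rewrite /Kjdt -/m /erase_bullets fnd_rem.
set U := foldl _ _ _ => Ub.
have -> : (b \in [fset b0 in domf U | U.[? b0] == Some bullet]) = (U.[? b] == Some bullet).
  by rewrite !inE andb_idl // => /eqP; case: fndP.
rewrite Ub; case Gx: (sws _ _ x) => [[j|[a|a]]|] //=.
  by case: (j =P k) => //=; rewrite eqxx.
by case: eqP => // -[e]; have := bm' _ _ Gx; rewrite e /bullet; lia.
Qed.

Lemma steps_other k i n j x G : j != k ->
  (sws (steps k i n) G x == Some (inl j)) = (G x == Some (inl j)).
Proof.
move=> jk; elim: n i G => //= n IH i G; rewrite IH.
case o: (on (inl k) (inr (Posz i)) (G x)); last by rewrite sw_off ?o.
have := on_sw (inl k) (inr (Posz i)) G x; rewrite o.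
have F v : on (inl k) (inr (Posz i)) v -> (v == Some (inl j)) = false.
  by move=> /orP[]/eqP-> //; apply/eqP => -[e]; rewrite e eqxx in jk.
by move=> /F->; rewrite F.
Qed.

Lemma sws_quarter l G : (forall x, G x <> None -> to_box x <> None) ->
  (forall x, sws l G x <> None -> to_box x <> None).
Proof.
elim: l G => //= p l IH G q x; apply: IH => {}x /eqP; rewrite sw_dom => /eqP.
exact: q.
Qed.

Lemma Krect_link M (o : seq {fset box}) k T G : bounded M G -> increasing k 0 G ->
  (forall j b, j < size o ->
     (b \in nth fset0 o j) = (G (of_box b) == Some (inl (k + j)%N))) ->
  (forall x, G x <> None -> to_box x <> None) ->
  gridof (fnd T) = (fun x => label_of (G x)) ->
  gridof (fnd (Krect T o)) =
    (fun x => label_of (sws [seq (inl j, inr i) | j <- iota k (size o), i <- ints 1 M] G x)).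
Proof.
elim: o k T G => [|X o IH] k T G bG iG oG qG TG //=.
rewrite sws_cat; apply: IH.
- exact: (steps_bounded (k := k) bG).
- apply: (@increasing_next _ M); first exact: (steps_bounded (k := k) bG).
  exact: (@increasing_steps _ 0).
- move=> j b jo; rewrite (steps_other 1 M); last by rewrite addSnnS -[X in _ != X]addn0 eqn_add2l.
  by have := oG j.+1 b jo; rewrite addSnnS.
- exact: sws_quarter.
apply: Kjdt_link bG iG _ qG TG => b.
by have := oG 0 b isT; rewrite addn0.
Qed.

End Link.

(** * Rectification orders *)

Section RectificationOrders.
Local Open Scope fset_scope.
Implicit Types (b c : box) (D : {fset box}) (o : seq {fset box}).

Definition leb2 b c := (b.1 <= c.1) && (b.2 <= c.2).

Lemma young_le D b c : young_diagram D -> c \in D -> leb2 b c -> b \in D.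
Proof. by case: b c => [i j] [i' j'] yD cD /andP[]; exact: yD. Qed.

Lemma corner_max D b c : inner_corner D b -> c \in D -> leb2 b c -> c = b.
Proof.
move=> [bD yb] cD l; apply/eqP; apply: contraT => ne.
have cDb : c \in D `\ b by rewrite !inE ne.
by have := young_le yb cDb l; rewrite !inE eqxx.
Qed.

Definition step_of o b := find (fun X : {fset box} => b \in X) o.

(** A chosen corner is maximal in the current inner shape, so every box southeast of it has been
    removed in a strictly earlier slide. *)
Lemma order_facts D o : young_diagram D -> rectification_order D o ->
  [/\ forall b, b \in D -> step_of o b < size o,
      forall b c, b \in D -> c \in D -> leb2 b c -> b <> c -> step_of o c < step_of o b
    & forall j b, j < size o -> (b \in nth fset0 o j) = (b \in D) && (step_of o b == j)].
Proof.
elim: o D => [|X o IH] D yD /=; first by move=> ->; split => // b; rewrite inE.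
move=> [_ Xc ord].
have XD b : b \in X -> b \in D by move=> /Xc[].
have yX : young_diagram (D `\` X).
  move=> i j i' j'; rewrite !inE => /andP[nX cD] li lj.
  have l : leb2 (i, j) (i', j') by apply/andP.
  rewrite (young_le yD cD l) andbT; apply: contra nX => bX.
  by rewrite (corner_max (Xc _ bX) cD l).
have [h1 h2 h3] := IH _ yX ord; rewrite /step_of /=; split.
- by move=> b bD; case: ifP => // nX; rewrite ltnS; apply: h1; rewrite inE nX.
- move=> b c bD cD l ne; case bX: (b \in X).
    by case: ne; rewrite (corner_max (Xc _ bX) cD l).
  by case cX: (c \in X) => //; rewrite ltnS; apply: h2 => //; rewrite inE ?bX ?cX.
move=> [|j] b jo /=.
  by case: ifP => bX; rewrite ?(XD _ bX) //= andbF.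
rewrite h3 // inE; case: ifP => bX /=; first by rewrite andbF.
by rewrite eqSS.
Qed.

(** A box with the largest coordinate sum is an inner corner, so boxes can be removed one at a
    time. *)
Lemma order_exists D : young_diagram D -> exists o, rectification_order D o.
Proof.
have [n] := ubnP #|` D|; elim: n D => // n IH D Dn yD.
case: (fset_0Vmem D) => [->|[b0 b0D]]; first by exists [::].
pose f (b : D) := ((val b).1 + (val b).2)%N.
have [b _ bmax] := @arg_maxnP _ [` b0D] xpredT f isT.
have yb : young_diagram (D `\ val b).
  move=> i j i' j'; rewrite !inE => /andP[ne cD] li lj.
  rewrite (yD _ _ _ _ cD li lj) andbT; apply: contra ne => /eqP e.
  have := bmax [` cD] isT; rewrite /f /= -e /= => h.
  have -> : i' = i by lia.
  by have -> : j' = j by lia.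
have [|o ord] := IH _ _ yb.
  by move: Dn; rewrite (cardfsD1 (val b)) (valP b) /=; lia.
exists ([fset val b] :: o); split => //.
  by apply/fset0Pn; exists (val b); rewrite inE.
by move=> x; rewrite inE => /eqP->; split => //; exact: valP.
Qed.

Implicit Types (x y : cell) (T U : filling).
Local Open Scope fmap_scope.

Definition cells (D : {fset box}) : seq cell := [seq of_box b | b <- D].

Lemma mem_cells D b : (of_box b \in cells D) = (b \in D).
Proof. by rewrite mem_map //; exact: of_box_inj. Qed.

Lemma cellsP D x : reflect (exists2 b, b \in D & x = of_box b) (x \in cells D).
Proof. exact: mapP. Qed.

Lemma uniq_cells D : uniq (cells D).
Proof. by rewrite map_inj_uniq; [exact: fset_uniq|exact: of_box_inj]. Qed.

Lemma le2_box b c : le2 (of_box b) (of_box c) <-> leb2 b c.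
Proof. by rewrite /le2 /leb2 /=; split; lia. Qed.

Lemma covers_box b c : covers (of_box b) (of_box c) ->
  c = (b.1.+1, b.2) \/ c = (b.1, b.2.+1).
Proof.
case: b c => [i j] [i' j'] /=; rewrite /covers /of_box /= => -[] [e1 e2]; [left|right];
by congr pair; lia.
Qed.

Definition entries_le (M : nat) T := forall b a, T.[? b] = Some a -> a <= M.

Lemma max_entry_le T : entries_le (max_entry T) T.
Proof.
move=> b a; case: fndP => // bT [<-].
by rewrite /max_entry (leq_bigmax (F := fun x : domf T => T x)).
Qed.

Lemma gridof_inj T U : gridof (fnd T) = gridof (fnd U) -> T = U.
Proof.
move=> e; apply/fmapP => b.
by have := congr1 (fun g => g (of_box b)) e; rewrite !gridof_box.
Qed.

Lemma label_collapse s G x : label_of (collapse s G x) = label_of (G x).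
Proof. by rewrite /collapse; case: (G x) => [[r|[a|a]]|]. Qed.

Definition fills (D : {fset box}) (A : Type) (G : grid A) : Prop :=
  forall x, G x <> None <-> x \in cells D.

Lemma fills_convex D (A : Type) (G : grid A) : young_diagram D -> fills D G -> forall x y z, le2 x y -> le2 y z ->
  G x <> None -> G z <> None -> G y <> None.
Proof.
move=> yD f x y z l1 l2 /f/cellsP[b bD ex] /f/cellsP[c cD ez]; subst x z; apply/f.
case: y l1 l2 => [[i|i] [j|j]] [/= ? ?] [/= ? ?]; try lia.
by rewrite (mem_cells _ (i, j)); apply: (young_le yD cD); apply/andP => /=; lia.
Qed.

End RectificationOrders.

(** * Independence of the rectification order *)

Section Independence.
Local Open Scope fset_scope.
Local Open Scope fmap_scope.
Implicit Types (b c : box) (x y : cell) (T U C : filling) (o : seq {fset box}).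
Variables lam nu : {fset box}.
Hypotheses (lam_young : young_diagram lam) (nu_young : young_diagram nu).
Hypothesis lam_nu : lam `<=` nu.

Let R : pred cell := fun z => z \in cells lam.
Hypothesis rectR : rect R.

Definition start T : grid sym := fun x =>
  if to_box x is Some b then
    if b \in lam then Some (inl x) else omap (fun a => inr (Posz a)) T.[? b]
  else None.

Lemma start_box T b : start T (of_box b) =
  if b \in lam then Some (inl (of_box b)) else omap (fun a => inr (Posz a)) T.[? b].
Proof. by rewrite /start of_boxK. Qed.

Lemma start_fills T : domf T = nu `\` lam -> fills nu (start T).
Proof.
move=> dT x; case xb: (to_box x) => [b|]; last first.
  rewrite /start xb; split => // /cellsP[b _ e].
  by move: xb; rewrite e of_boxK.
rewrite (to_boxP xb) mem_cells start_box; case: ifP => bl.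
  by split => // _; apply: (fsubsetP lam_nu).
case: fndP => /= [bT|nbT].
  by split => // _; move: (bT); rewrite dT inE => /andP[].
by split => // bn; case/negP: nbT; rewrite dT inE bl.
Qed.

Lemma INC_lt T mu D b c u v : INC D mu T -> covers (of_box b) (of_box c) ->
  T.[? b] = Some u -> T.[? c] = Some v -> u < v.
Proof.
move=> [_ _ row col] /covers_box [] ->; case: b => [i j] /= Tb Tc.
  exact: col Tb Tc (ltnSn _).
exact: row Tb Tc (ltnSn _).
Qed.

(** Each label sits in its own cell, which gives the row and column conditions at once. Entries are
    at least 1, so with [i = 1] all labels precede them in [prec]. *)
Lemma start_good T : INC nu lam T -> good R pred0 1 (start T).
Proof.
move=> incT; have [dT Tpos _ _] := incT.
have sl x r : start T x = Some (inl r) -> [/\ r = x & R x].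
  rewrite /start; case xb: (to_box x) => [b|] //; case: ifP => bl.
    by move=> [<-]; split => //; rewrite /R (to_boxP xb) mem_cells.
  by case: fndP.
split.
- exact: fills_convex nu_young (start_fills dT).
- by move=> x r /sl[->].
- move=> r Rr; exists r; have /cellsP[b bl ->] := Rr.
  by rewrite start_box bl.
- by move=> x y p p' q /sl[<- _] /sl[<- _] /=; lia.
- by move=> x y p p' q /sl[<- _] /sl[<- _] /=; lia.
move=> x y u v c Gx Gy.
have [b bD ex] : exists2 b, b \in nu & x = of_box b.
  by apply/cellsP; apply/(start_fills dT); rewrite Gx.
have [b' bD' ey] : exists2 b, b \in nu & y = of_box b.
  by apply/cellsP; apply/(start_fills dT); rewrite Gy.
subst x y; have l : leb2 b b' by apply/le2_box; apply: covers_le2.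
move: Gx Gy; rewrite !start_box; case: ifP => bl; case: ifP => bl'.
- by move=> [<-] [<-]; rewrite /prec /=; case: c => -[-> ->]; lia.
- case Tb': (T.[? b']) => [a|] //= [<-] [<-]; have := Tpos _ _ Tb'.
  by rewrite /prec /=; lia.
- by move: bl; rewrite (young_le lam_young bl' l).
case Tb: (T.[? b]) => [a|] //=; case Tb': (T.[? b']) => [a'|] //= [<-] [<-].
by have := INC_lt incT c Tb Tb'; rewrite /prec /=; lia.
Qed.

Lemma start_bounded M T : INC nu lam T -> entries_le M T -> bounded M (start T).
Proof.
move=> [_ Tpos _ _] TM x a; rewrite /start.
case: (to_box x) => [b|] //; case: ifP => // _.
by case Tb: (T.[? b]) => [a'|] //= [<-]; have := Tpos _ _ Tb; have := TM _ _ Tb; lia.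
Qed.

Definition step_of_cell o x := if to_box x is Some b then step_of o b else 0.

Lemma step_decreasing o : rectification_order lam o ->
  forall r r', R r -> R r' -> le2 r r' -> r <> r' -> step_of_cell o r' < step_of_cell o r.
Proof.
move=> ord _ _ /cellsP[b bl ->] /cellsP[c cl ->] /le2_box l ne.
rewrite /step_of_cell !of_boxK; have [_ h _] := order_facts lam_young ord.
by apply: h => // e; apply: ne; rewrite e.
Qed.

Lemma step_bound o : rectification_order lam o ->
  forall r, R r -> step_of_cell o r < size o.
Proof.
move=> ord _ /cellsP[b bl ->]; rewrite /step_of_cell of_boxK.
by have [h _ _] := order_facts lam_young ord; exact: h.
Qed.

Lemma start_increasing T o : INC nu lam T -> rectification_order lam o ->
  increasing 0 0 (collapse (step_of_cell o) (start T)).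
Proof.
move=> incT ord x y u v c; rewrite /collapse.
have g := start_good incT; have st := good_strict g c.
have sl z r : start T z = Some (inl r) -> r = z /\ R z.
  move=> Gz; split; last first.
    have : start T z <> None by rewrite Gz.
    move: Gz; rewrite /start; case zb: (to_box z) => [b|] //; case: ifP => bl.
      by rewrite /R (to_boxP zb) mem_cells.
    by case: fndP.
  move: Gz; rewrite /start; case: (to_box z) => // b; case: ifP => _; first by case.
  by case: fndP.
case Gx: (start T x) => [[r|a]|] //= [<-]; case Gy: (start T y) => [[r'|a']|] //= [<-].
- have [er Rx] := sl _ _ Gx; have [er' Ry] := sl _ _ Gy; subst r r'.
  have ne : x <> y by move=> e; move: c; rewrite e => -[] /(congr1 (fun z => (z.1 + z.2)%R)) /=; lia.
  have := step_decreasing ord Rx Ry (covers_le2 c) ne.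
  by rewrite /before /=; do 2?[case: eqP => ? /=]; lia.
- have := st _ _ Gx Gy; rewrite /prec /before /=; have := start_bounded incT (@max_entry_le T) Gy.
  by case: eqP => ? /=; lia.
- have := st _ _ Gx Gy; rewrite /prec /before /=; have := start_bounded incT (@max_entry_le T) Gx.
  by lia.
- by have := st _ _ Gx Gy; rewrite /prec /before /=; lia.
Qed.

(** The right side does not mention [o], so two orders are compared through one [w]. That [M] may
    exceed the largest entry lets one bound serve a tableau and its rectification. *)
Lemma Krect_run T o w M : INC nu lam T -> rectification_order lam o ->
  entries_le M T -> descending R pred0 w -> perm_eq w (cells lam) ->
  gridof (fnd (Krect T o)) = (fun x => label_of (run w (ints 1 M) (start T) x)).
Proof.
move=> incT ord TM wd wR; have g := start_good incT; have [dT _ _ _] := incT.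
rewrite (@Krect_link M o 0 T (collapse (step_of_cell o) (start T))).
- rewrite -(run_collapse rectR (uniq_cells lam) wd wR _ (step_decreasing ord) (step_bound ord) g).
  by apply: functional_extensionality => x; rewrite label_collapse.
- move=> x a; rewrite /collapse; case Gx: (start T x) => [[r|a']|] //= [<-].
  exact: start_bounded incT TM _ _ Gx.
- exact: start_increasing.
- move=> j b jo; have [_ _ ->] := order_facts lam_young ord => //.
  rewrite /collapse start_box; case: ifP => bl /=.
    by rewrite /step_of_cell of_boxK (inj_eq (@Some_inj _)).
  by case: fndP.
- by move=> x; rewrite /collapse /start; case: (to_box x).
apply: functional_extensionality => x; rewrite label_collapse /gridof /start.
case: (to_box x) => // b /=; case: ifP => bl; last by case: fndP.
by rewrite not_fnd // -[_ \in _]/(b \in domf T) dT inE bl.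
Qed.

Lemma order_list o : rectification_order lam o ->
  exists2 w, descending R pred0 w & perm_eq w (cells lam).
Proof.
move=> ord; exists (levels (cells lam) (step_of_cell o) 0 (size o)).
  exact: levels_descending0 (uniq_cells lam) (step_decreasing ord) _.
exact: levels_perm (uniq_cells lam) (step_decreasing ord) _ (step_bound ord).
Qed.

Lemma Krect_order_independent T o1 o2 : INC nu lam T ->
  rectification_order lam o1 -> rectification_order lam o2 -> Krect T o1 = Krect T o2.
Proof.
move=> incT ord1 ord2; apply: gridof_inj; have [w wd wR] := order_list ord1.
by rewrite (Krect_run incT ord1 (@max_entry_le T) wd wR) (Krect_run incT ord2 (@max_entry_le T) wd wR).
Qed.

End Independence.

(** * Counting *)

Section FinalPosition.
Local Open Scope fset_scope.
Local Open Scope fmap_scope.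
Implicit Types (b c : box) (x y : cell) (C : filling).
Variables lam nu mu : {fset box}.
Hypotheses (nu_young : young_diagram nu) (mu_young : young_diagram mu).
Implicit Types f : {ffun nu -> option lam}.
Let R : pred cell := fun z => z \in cells lam.

(* C on mu, where f is None, and the labels given by f elsewhere. *)
Definition final C f : grid sym := fun x =>
  if to_box x is Some b then
    if insub b : option nu is Some v then
      if f v is Some r then Some (inl (of_box (val r)))
      else omap (fun a => inr (Posz a)) C.[? b]
    else None
  else None.

Lemma final_box C f (v : nu) : final C f (of_box (val v)) =
  if f v is Some r then Some (inl (of_box (val r)))
  else omap (fun a => inr (Posz a)) C.[? val v].
Proof. by rewrite /final of_boxK valK. Qed.

Lemma final_inside C f x u : final C f x = Some u -> exists v : nu, x = of_box (val v).
Proof.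
rewrite /final; case xb: (to_box x) => [b|] //; case: insubP => // v _ e _.
by exists v; rewrite e; apply: to_boxP.
Qed.

(** This is the state in which the entries up to [M] have passed all labels and [M + 1] would be
    next. The type of [f] is finite, so the labellings can be counted. *)
Definition admissible C M f : Prop :=
  [/\ INC mu fset0 C, mu `<=` nu, forall v : nu, f v = None <-> val v \in mu
    & good R pred0 (Posz M + 1) (final C f)].

Lemma domC C b : INC mu fset0 C -> (b \in domf C) = (b \in mu).
Proof. by move=> [dC _ _ _]; rewrite dC inE inE. Qed.

Lemma final_fills C f : INC mu fset0 C -> (forall v : nu, f v = None <-> val v \in mu) ->
  fills nu (final C f).
Proof.
move=> incC fN x; split.
  by case Fx: (final C f x) => [u|] // _; have [v ->] := final_inside Fx; rewrite mem_cells; exact: fsvalP.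
case/cellsP => b bn ->; rewrite -[b]/(val [` bn]) final_box.
case fv: (f _) => [r|] //; have /fN := fv; rewrite -(domC _ incC) => bC.
by rewrite in_fnd.
Qed.

Lemma final_bounded C M f : INC mu fset0 C -> entries_le M C -> bounded M (final C f).
Proof.
move=> [_ Cpos _ _] CM x a Fx; have [v ex] := final_inside Fx; move: Fx.
rewrite ex final_box; case: (f v) => //; case Cv: (C.[? _]) => [a'|] //= [<-].
by have := Cpos _ _ Cv; have := CM _ _ Cv; lia.
Qed.

(** With [M + 1] next, entries have class at most -2 and labels have class -1, whatever the values.
    Conditions on labels involve only [f], those among entries say that [C] is increasing, and no
    label stands directly before an entry because [mu] is a Young diagram. *)
Lemma admissible_transfer C0 M0 C M f : admissible C0 M0 f -> INC mu fset0 C ->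
  entries_le M C -> admissible C M f.
Proof.
move=> [incC0 munu fN g] incC CM; split => //.
have F := final_fills incC fN; have bC := final_bounded (f := f) incC CM.
have E x r : final C f x = Some (inl r) <-> final C0 f x = Some (inl r).
  rewrite /final; case: (to_box x) => // b; case: insubP => // v _ _.
  by case: (f v) => //; split; case: (C.[? b]) (C0.[? b]) => [?|] [?|].
split.
- exact: fills_convex nu_young F.
- by move=> x r /E; apply: (good_label g).
- by move=> r /(good_onto g)[x Gx]; exists x; apply/E.
- by move=> x y p p' q /E Gx /E Gy; apply: (good_col g Gx Gy).
- by move=> x y p q q' /E Gx /E Gy; apply: (good_row g Gx Gy).
move=> x y [r|a] [r'|a'] c Gx Gy.
- have := good_strict g c ((E _ _).1 Gx) ((E _ _).1 Gy).
  by rewrite /prec.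
- have [v ex] := final_inside Gx; have [v' ey] := final_inside Gy; subst x y.
  have l : leb2 (val v) (val v') by apply/le2_box; exact: covers_le2.
  move: Gx Gy; rewrite !final_box; case fv: (f v) => [s|] //; last by case: (C.[? _]).
  case fv': (f v') => // _ _; have /fN v'mu := fv'.
  by have /fN := young_le mu_young v'mu l; rewrite fv.
- by have := bC _ _ Gx; rewrite /prec /=; lia.
have [v ex] := final_inside Gx; have [v' ey] := final_inside Gy; subst x y.
move: Gx Gy; rewrite !final_box; case: (f v) => //; case: (f v') => //.
case Cv: (C.[? _]) => [b|] //=; case Cv': (C.[? _]) => [b'|] //= [<-] [<-].
by have := INC_lt incC c Cv Cv'; rewrite /prec /=; lia.
Qed.

Lemma label_final C f : INC mu fset0 C -> mu `<=` nu ->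
  (forall v : nu, f v = None <-> val v \in mu) ->
  (fun x => label_of (final C f x)) = gridof (fnd C).
Proof.
move=> incC munu fN; apply: functional_extensionality => x; rewrite /final /gridof.
case: (to_box x) => //= b; case: insubP => [v _ e|nb].
  subst b; case fv: (f v) => [r|]; last by case: (C.[? _]).
  rewrite not_fnd // -[_ \in _]/(_ \in domf C) (domC _ incC).
  by apply/negP => /fN; rewrite fv.
rewrite not_fnd // -[_ \in _]/(_ \in domf C) (domC _ incC).
by apply: contra nb => /(fsubsetP munu).
Qed.

End FinalPosition.

Section Counting.
Local Open Scope fset_scope.
Local Open Scope fmap_scope.
Implicit Types (b c : box) (x y : cell) (T U C : filling) (o : seq {fset box}).
Variables lam nu : {fset box}.
Hypotheses (lam_young : young_diagram lam) (nu_young : young_diagram nu).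
Hypothesis lam_nu : lam `<=` nu.
Let R : pred cell := fun z => z \in cells lam.
Hypothesis rectR : rect R.

Lemma exec_dom i L (G : grid sym) x : (exec i L G x == None) = (G x == None).
Proof. by elim: L G => //= r L IH G; rewrite IH sw_dom. Qed.

Lemma unrun_dom w l (G : grid sym) x : (unrun w l G x == None) = (G x == None).
Proof. by elim: l => //= i l IH; rewrite exec_dom. Qed.

Lemma run_dom w l (G : grid sym) x : (run w l G x == None) = (G x == None).
Proof. by elim: l G => //= i l IH G; rewrite IH exec_dom. Qed.

Lemma exec_bounded i L M (G : grid sym) : bounded M G -> (1 <= i <= Posz M)%R ->
  bounded M (exec i L G).
Proof. by elim: L G => //= r L IH G bG iM; apply: IH => //; apply: bounded_sw. Qed.

Lemma ints_bound M i : i \in ints 1 M -> (1 <= i <= Posz M)%R.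
Proof. by case/mapP => j; rewrite mem_iota => jM ->; lia. Qed.

Lemma run_bounded w l M (G : grid sym) : bounded M G -> {subset l <= ints 1 M} ->
  bounded M (run w l G).
Proof.
elim: l G => //= i l IH G bG s; apply: IH.
  by apply: exec_bounded => //; apply/ints_bound/s; rewrite inE eqxx.
by move=> j jl; apply: s; rewrite inE jl orbT.
Qed.

Lemma unrun_bounded w l M (G : grid sym) : bounded M G -> {subset l <= ints 1 M} ->
  bounded M (unrun w l G).
Proof.
elim: l => //= i l IH bG s; apply: exec_bounded; last first.
  by apply/ints_bound/s; rewrite inE eqxx.
by apply: IH => // j jl; apply: s; rewrite inE jl orbT.
Qed.

Lemma unrun_absent w k n M J i (G : grid sym) : good R J i G -> bounded M G -> M < k ->
  unrun w (ints k n) G = G.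
Proof.
move=> g bG; elim: n k => //= n IH k Mk; rewrite IH; last exact: ltnW.
have E r : sw (inl r) (inr (Posz k)) G = G.
  have apart y z : covers y z -> G y = Some (inl r) -> G z = Some (inl r) -> False.
    by move=> c Gy Gz; have := good_strict g c Gy Gz => /prec_irr.
  have nk y : G y <> Some (inr (Posz k)) by move=> /bG; lia.
  apply: functional_extensionality => x; rewrite /sw.
  case: ifP => // /andP[/orP[]/eqP Gx]; last by case: (nk x).
  move=> /touchedP[y [] c /orP[]/eqP Gy]; try by case: (nk y).
    by case: (apart _ _ c Gx Gy).
  by case: (apart _ _ c Gy Gx).
by elim: (rev w) => //= r l IHl; rewrite E.
Qed.

(** The labels above [r] in its column occupy strictly higher rows, so the row of [x] is at least
    that of [r]; likewise for columns. Conversely, a walk north or west from [x] meets only labels,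
    since no entry can precede a label, and their coordinate sums decrease strictly; so the sum of
    [r] is at least that of [x]. *)
Lemma straight M (G : grid sym) x r : fills nu G -> bounded M G -> good R pred0 1 G ->
  G x = Some (inl r) -> r = x.
Proof.
move=> fG bG g.
have down (p q p' q' : nat) : R (Posz p, Posz q) -> p' <= p -> q' <= q -> R (Posz p', Posz q').
  rewrite /R (mem_cells _ (p, q)) (mem_cells _ (p', q')) => h h1 h2.
  exact: lam_young h h1 h2.
have row n q y : G y = Some (inl (Posz n, Posz q)) -> (Posz n <= y.1)%R.
  elim: n y => [|n IH] y Gy.
    have : y \in cells nu by apply/fG; rewrite Gy.
    by case/cellsP => b _ ->; rewrite /=; lia.
  have [z Gz] := good_onto g (down _ _ n q (good_label g Gy) (leqnSn n) (leqnn q)).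
  by have [|h _] := good_col g Gz Gy; [lia|have := IH _ Gz; lia].
have col n p y : G y = Some (inl (Posz p, Posz n)) -> (Posz n <= y.2)%R.
  elim: n y => [|n IH] y Gy.
    have : y \in cells nu by apply/fG; rewrite Gy.
    by case/cellsP => b _ ->; rewrite /=; lia.
  have [z Gz] := good_onto g (down _ _ p n (good_label g Gy) (leqnn p) (leqnSn n)).
  by have [|h _] := good_row g Gz Gy; [lia|have := IH _ Gz; lia].
have height n : forall (b : box) r', (b.1 + b.2)%N = n -> G (of_box b) = Some (inl r') ->
    (Posz n <= r'.1 + r'.2)%R.
  elim: n => [|n IH] b r' bn Gb.
    by have /cellsP[c _ ->] := good_label g Gb; rewrite /=; lia.
  have [b' cb b'n] : exists2 b', covers (of_box b') (of_box b) & (b'.1 + b'.2)%N = n.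
    case: b bn {Gb} => [[|i] j] /= bn.
      case: j bn => // j [jn]; exists (0, j) => //.
      by right; apply: eq_cell => /=; lia.
    exists (i, j); first by left; apply: eq_cell => /=; lia.
    by move: bn; rewrite /= addSn => -[].
  have b'nu : b' \in nu.
    have : of_box b \in cells nu by apply/fG; rewrite Gb.
    rewrite mem_cells => bnu; apply: (young_le nu_young bnu).
    by apply/le2_box; exact: covers_le2.
  case Gb': (G (of_box b')) => [[r1|a]|].
  - have := good_strict g cb Gb' Gb; rewrite /prec /=.
    by have := IH _ _ b'n Gb'; lia.
  - have := good_strict g cb Gb' Gb; rewrite /prec /=.
    by have := bG _ _ Gb'; lia.
  - by have := (fG (of_box b')).2; rewrite mem_cells Gb' => /(_ b'nu) /(_ erefl).
move=> Gx; have /cellsP[b _ ex] : x \in cells nu by apply/fG; rewrite Gx.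
have /cellsP[c _ er] := good_label g Gx; subst x r.
have h := height _ b _ erefl Gx; have h1 := row _ _ _ Gx; have h2 := col _ _ _ Gx.
by apply: eq_cell; move: h h1 h2; rewrite /=; lia.
Qed.

(** The default 0 is not reached for the grids of [start_fill], where every box outside [lam]
    carries a positive entry. *)
Definition fill (G : grid sym) : filling :=
  [fmap v : nu `\` lam => odflt 0 (label_of (G (of_box (val v))))].

Lemma start_fill M (G : grid sym) : fills nu G -> bounded M G -> good R pred0 1 G ->
  [/\ start lam (fill G) = G, INC nu lam (fill G) & entries_le M (fill G)].
Proof.
move=> fG bG g.
have inR b : b \in lam -> G (of_box b) = Some (inl (of_box b)).
  move=> bl; have Rb : R (of_box b) by rewrite /R mem_cells.
  have [x Gx] := good_onto g Rb.
  by have e := straight fG bG g Gx; rewrite -e in Gx.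
have outR b : b \in nu `\` lam -> exists2 a : nat,
    G (of_box b) = Some (inr (Posz a)) & (fill G).[? b] = Some a.
  move=> bnl; have := bnl; rewrite inE => /andP[nb bn].
  case Gb: (G (of_box b)) => [[r|a]|].
  - have e := straight fG bG g Gb; subst r.
    by have := good_label g Gb; rewrite /R mem_cells (negbTE nb).
  - case: a Gb => a Gb; last by have := bG _ _ Gb; lia.
    exists a => //; rewrite (@in_fnd _ _ (fill G) b bnl) ffunE.
    by rewrite /= Gb.
  - by have := (fG (of_box b)).2; rewrite mem_cells Gb => /(_ bn) /(_ erefl).
have back b a : (fill G).[? b] = Some a -> G (of_box b) = Some (inr (Posz a)).
  move=> e; have bF : b \in nu `\` lam by move: e; case: fndP.
  by have [a' -> e'] := outR b bF; move: e; rewrite e' => -[->].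
split.
- apply: functional_extensionality => x; rewrite /start.
  case xb: (to_box x) => [b|]; last first.
    case Gx: (G x) => [u|] //; have : x \in cells nu by apply/fG; rewrite Gx.
    by case/cellsP => b _ e; move: xb; rewrite e of_boxK.
  rewrite (to_boxP xb); case: ifP => bl; first by rewrite inR.
  case bn: (b \in nu); first by have [|a -> ->] := outR b; rewrite // inE bl bn.
  rewrite not_fnd /=; last by rewrite -[_ \in _]/(b \in nu `\` lam) inE bn andbF.
  by case Gb: (G _) => [u|] //; have := (fG (of_box b)).1; rewrite mem_cells bn Gb; case.
- split => //.
  + by move=> b u /back/bG; lia.
  + move=> i j j' u v /back Gu /back Gv jj.
    have l : le2 (of_box (i, j)) (of_box (i, j')) by split => /=; lia.
    have ne : of_box (i, j) <> of_box (i, j') by move=> []; lia.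
    by have := good_lt g l ne Gu Gv; rewrite /prec /=; lia.
  + move=> i i' j u v /back Gu /back Gv jj.
    have l : le2 (of_box (i, j)) (of_box (i', j)) by split => /=; lia.
    have ne : of_box (i, j) <> of_box (i', j) by move=> []; lia.
    by have := good_lt g l ne Gu Gv; rewrite /prec /=; lia.
- by move=> b a /back/bG; lia.
Qed.

Variables (w : seq cell) (mu : {fset box}).
Hypotheses (wd : descending R pred0 w) (wR : perm_eq w (cells lam)).
Hypothesis mu_young : young_diagram mu.
Implicit Types f : {ffun nu -> option lam}.

Definition source C f : filling := fill (unrun w (ints 1 (max_entry C)) (final C f)).

Lemma source_spec C f : admissible mu C (max_entry C) f ->
  [/\ INC nu lam (source C f), entries_le (max_entry C) (source C f)
    & run w (ints 1 (max_entry C)) (start lam (source C f)) = final C f].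
Proof.
set M := max_entry C => -[incC munu fN g].
have g1 : good R pred0 1 (unrun w (ints 1 M) (final C f)).
  by apply: (@unrun_good _ w rectR wd wR 1 M); rewrite addnC PoszD.
have F : fills nu (unrun w (ints 1 M) (final C f)).
  move=> x; rewrite -(final_fills incC fN x).
  by split=> /eqP h; apply/eqP; move: h; rewrite unrun_dom.
have b1 : bounded M (unrun w (ints 1 M) (final C f)).
  by apply: unrun_bounded => //; apply: (final_bounded incC (@max_entry_le C)).
have [e i1 i2] := start_fill F b1 g1.
by split => //; rewrite /source -/M e unrunK.
Qed.

Lemma source_rectifies C f o : rectification_order lam o ->
  admissible mu C (max_entry C) f -> Krect (source C f) o = C.
Proof.
move=> ord ad; have [i1 i2 e] := source_spec ad; have [incC munu fN _] := ad.
apply: gridof_inj; rewrite (Krect_run lam_young nu_young lam_nu rectR i1 ord i2 wd wR) e.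
exact: (label_final incC munu).
Qed.

Lemma source_inj C f f' : admissible mu C (max_entry C) f ->
  admissible mu C (max_entry C) f' -> source C f = source C f' -> f = f'.
Proof.
move=> ad ad' e; have [_ _ E] := source_spec ad; have [_ _ E'] := source_spec ad'.
have {E E'} E : final C f = final C f' by rewrite -E -E' e.
apply/ffunP => v; have := congr1 (fun G => G (of_box (val v))) E; rewrite !final_box.
case: (f v) (f' v) => [r|] [r'|] //.
- move=> [e1 e2]; congr Some; apply: val_inj; apply: of_box_inj.
  by apply: eq_cell => /=; congr Posz.
- by case: (C.[? _]).
- by case: (C.[? _]).
Qed.

Lemma start_inj T U : INC nu lam T -> INC nu lam U -> start lam T = start lam U -> T = U.
Proof.
move=> [dT _ _ _] [dU _ _ _] e; apply/fmapP => b.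
have := congr1 (fun G => G (of_box b)) e; rewrite !start_box; case: ifP => bl.
  have N (V : filling) : domf V = nu `\` lam -> V.[? b] = None.
    by move=> dV; rewrite not_fnd // -[_ \in _]/(b \in domf V) dV inE bl.
  by rewrite !N.
by case: (T.[? b]) (U.[? b]) => [u|] [v|] //= [->].
Qed.

Lemma source_onto C T o : INC mu fset0 C -> INC nu lam T -> rectification_order lam o ->
  Krect T o = C -> exists2 f, admissible mu C (max_entry C) f & T = source C f.
Proof.
(* The run from [T] needs a bound on the entries of [T], while [source] undoes only the entries up
   to [m]; both are compared inside [M]. *)
move=> incC incT ord KT; set m := max_entry C; pose M := maxn (max_entry T) m.
have TM : entries_le M T by move=> b a /max_entry_le h; rewrite (leq_trans h) ?leq_maxl.
pose G := run w (ints 1 M) (start lam T).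
have lG : gridof (fnd C) = (fun x => label_of (G x)).
  by rewrite -KT (Krect_run lam_young nu_young lam_nu rectR incT ord TM wd wR).
have g0 := start_good lam_young nu_young lam_nu incT.
have gG : good R pred0 (Posz M + 1) G.
  by have := @run_good _ w rectR wd wR 1 M _ g0; rewrite addnC PoszD.
have [dT _ _ _] := incT.
have fG : fills nu G.
  move=> x; rewrite -(start_fills lam_nu dT x).
  by split=> /eqP h; apply/eqP; move: h; rewrite run_dom.
have bG : bounded M G by apply: run_bounded => //; exact: start_bounded incT TM.
have CG b : C.[? b] = label_of (G (of_box b)) by rewrite -[LHS]gridof_box lG.
(* The labelling is read off the end of the run. *)
pose f : {ffun nu -> option lam} := [ffun v =>
  if G (of_box (val v)) is Some (inl r) then obind insub (to_box r) else None].
have fE (v : nu) : match G (of_box (val v)) with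
    | Some (inl r) => exists2 s, f v = Some s & r = of_box (val s)
    | Some (inr a) => f v = None /\ exists2 a', a = Posz a' & C.[? val v] = Some a'
    | None => False end.
  rewrite ffunE CG; case Gv: (G _) => [[r|a]|].
  - have /cellsP[b bl ->] := good_label gG Gv; exists [` bl] => //.
    by rewrite of_boxK /= insubT.
  - by split => //; case: a Gv => a Gv; [exists a|have := bG _ _ Gv; lia].
  - by have := (fG (of_box (val v))).2; rewrite mem_cells Gv => /(_ (fsvalP v)) /(_ erefl).
have fin : final C f = G.
  apply: functional_extensionality => x; rewrite /final.
  case xb: (to_box x) => [b|]; last first.
    case Gx: (G x) => [u|] //; have /cellsP[b _ e] : x \in cells nu.
      by apply/fG; rewrite Gx.
    by move: xb; rewrite e of_boxK.
  rewrite (to_boxP xb); case: insubP => [v _ e|nb].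
    subst b; have := fE v; by case: (G _) => [[r|a]|] //; [move=> [s -> ->]|move=> [-> [a' -> ->]]].
  by case Gb: (G _) => [u|] //; have := (fG (of_box b)).1; rewrite mem_cells Gb (negbTE nb); case.
have fN (v : nu) : f v = None <-> val v \in mu.
  rewrite -(domC _ incC); have := fE v; case Gv: (G _) => [[r|a]|] //.
    by move=> [s -> _]; split => // vC; have := CG (val v); rewrite Gv (in_fnd vC).
  by move=> [-> [a' _ Ca]]; split => // _; move: Ca; case: fndP.
have munu : mu `<=` nu.
  apply/fsubsetP => b; rewrite -(domC _ incC) => bC.
  have := CG b; rewrite (in_fnd bC); case Gb: (G _) => [u|] // _.
  by have := (fG (of_box b)).1; rewrite Gb mem_cells; apply.
have ad : admissible mu C M f by split; rewrite ?fin.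
have adm : admissible mu C m f by apply: admissible_transfer ad incC (@max_entry_le C).
exists f => //.
have [incS _ E] := source_spec adm; apply: start_inj => //.
have bm : bounded m G by rewrite -fin; apply: (final_bounded incC (@max_entry_le C)).
have -> : start lam T = unrun w (ints 1 m) G.
  rewrite -[LHS](runK w (ints 1 M)) -/G.
  (* Entries above [m] do not occur in [G], so undoing them is the identity. *)
  have -> : ints 1 M = ints 1 m ++ ints (1 + m) (M - m).
    by rewrite -map_cat -iotaD subnKC // leq_maxr.
  by rewrite /unrun foldr_cat -!/(unrun w _ _) (unrun_absent w _ gG bm).
by rewrite -[RHS](runK w (ints 1 m)) E fin.
Qed.

End Counting.

(** * Rectangles and the two statements *)

Local Open Scope fset_scope.

Lemma in_rectangle a b i j : ((i, j) \in rectangle a b) = (i < a) && (j < b).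
Proof.
rewrite /rectangle inE; apply/allpairsP/andP => [[[i' j'] /= []]|[ia jb]].
  by rewrite !mem_iota !add0n => ? ? [-> ->].
by exists (i, j); rewrite !mem_iota.
Qed.

Lemma rectangle_young a b : young_diagram (rectangle a b).
Proof.
move=> i j i' j'; rewrite !in_rectangle => /andP[ia jb] ii jj.
by rewrite (leq_ltn_trans ii ia) (leq_ltn_trans jj jb).
Qed.

Lemma rectangle_rect a b : rect (fun z => z \in cells (rectangle a b)).
Proof.
move=> p q p' q' /cellsP[[i j] r1 [-> _]] /cellsP[[i' j'] r2 [_ ->]].
move: r1 r2; rewrite (mem_cells _ (i, j')) !in_rectangle.
by move=> /andP[-> _] /andP[_ ->].
Qed.

Theorem theorem1p2 (a b : nat) (nu : {fset box})
    (nu_young : young_diagram nu) (sub_nu : rectangle a b `<=` nu) :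
  (forall T : filling, INC nu (rectangle a b) T ->
     forall o1 o2 : seq {fset box},
       rectification_order (rectangle a b) o1 ->
       rectification_order (rectangle a b) o2 ->
       Krect T o1 = Krect T o2)
  /\
  (forall mu : {fset box}, young_diagram mu ->
     exists N : nat, forall C : filling, INC mu fset0 C ->
       exists2 S : {fset filling},
         (forall T : filling,
            T \in S <->
            INC nu (rectangle a b) T /\ Krectifies_to (rectangle a b) T C)
         & #|` S| = N).
Proof.
set lam := rectangle a b in sub_nu *.
have lam_young : young_diagram lam := @rectangle_young a b.
have lam_rect := @rectangle_rect a b; rewrite -/lam in lam_rect.
split=> [T incT o1 o2|mu mu_young].
  move=> ord1 ord2. exact: (Krect_order_independent lam_young nu_young sub_nu lam_rect incT ord1 ord2).
have [o ord] := order_exists lam_young.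
have [w wd wR] := order_list lam_young ord.
(* The tableau and the bound are quantified away, so that the number is fixed before [C] is given;
   [admissible_transfer] then supplies the given [C]. *)
pose good_labels (f : {ffun nu -> option lam}) := exists C M, admissible mu C M f.
pose V := [fset f : {ffun nu -> option lam} |
  if excluded_middle_informative (good_labels f) then true else false].
have VP f : f \in V -> good_labels f.
  by rewrite !inE; case: excluded_middle_informative.
exists #|` V| => C incC.
have ad f : f \in V -> admissible mu C (max_entry C) f.
  move=> /VP[C0 [M0 ad0]].
  exact: (admissible_transfer nu_young mu_young ad0 incC (@max_entry_le C)).
exists (source w C @` V); last first.
  apply/eqP/card_in_imfsetP => f f' /ad ad1 /ad ad2.
  exact: (source_inj lam_young nu_young sub_nu lam_rect wd wR ad1 ad2).
move=> T; split.
  move=> /imfsetP[f /= /ad adf ->]; split.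
    by have [] := source_spec lam_young nu_young sub_nu lam_rect wd wR adf.
  by exists o => //; exact: (source_rectifies lam_young nu_young sub_nu lam_rect wd wR ord adf).
move=> [incT [o' ord' KT]].
have [f adf ->] := source_onto lam_young nu_young sub_nu lam_rect wd wR mu_young incC incT ord' KT.
apply/imfsetP; exists f => //=; rewrite !inE.
by case: excluded_middle_informative => // -[]; exists C, (max_entry C).
Qed.
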